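(* Let $\Delta$ and $\Gamma$ be atomic graphs. Then $\mathbb{G}(\Delta)$ embeds as a subgroup in $\mathbb{G}(\Gamma)$ and $\mathbb{G}(\Gamma)$ embeds as a subgroup in $\mathbb{G}(\Delta)$ if and only if $\Delta$ and $\Gamma$ are isomorphic.
   Context: A finite simplicial graph is atomic if it is connected, has no vertices of valence $1$, has no cycles of length less than $5$, and the closed star of no vertex separates it. $\mathbb{G}(\Gamma)$ is the pc group (right-angled Artin group) with generators $V(\Gamma)$ and relations $[u,v]=1$ for each edge of $\Gamma$. *)

(* Defs.v *)
From mathcomp Require Import all_boot.
Set Implicit Arguments. Unset Strict Implicit. Unset Printing Implicit Defensive.

Record sgraph := SGraph {
  vert : finType;
  adj : rel vert;
  adj_sym : symmetric adj;
  adj_irr : irreflexive adj }.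

Section Graphs.
Variable G : sgraph.
Local Notation V := (vert G).
Local Notation e := (@adj G).

Definition connected_graph : Prop :=
  (0 < #|V|) /\ forall x y : V, connect e x y.

Definition nbhd (v : V) : {set V} := [set w | e v w].

Definition no_valence_one : Prop := forall v : V, #|nbhd v| != 1.

Definition no_short_cycles : Prop :=
  forall s : seq V, uniq s -> cycle e s -> 3 <= size s -> 5 <= size s.

Definition closed_star (v : V) : {set V} := v |: nbhd v.

Definition separates (S : {set V}) : Prop :=
  exists x y : V, [/\ x \notin S, y \notin S &
    ~~ connect [rel a b | [&& e a b, a \notin S & b \notin S]] x y].

Definition atomic : Prop :=
  [/\ connected_graph, no_valence_one, no_short_cycles &
      forall v : V, ~ separates (closed_star v)].

(* a letter (v, false) is the generator v, (v, true) is its inverse *)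
Definition letter := (V * bool)%type.
Definition word := seq letter.
Definition linv (x : letter) : letter := (x.1, ~~ x.2).
Definition winv (w : word) : word := rev (map linv w).
Definition commw (u v : V) : word := [:: (u, false); (v, false); (u, true); (v, true)].

(* equality in the group with presentation <V | [u,v] = 1 for u ~ v> *)
Inductive raag_eq : word -> word -> Prop :=
| req_refl w : raag_eq w w
| req_sym w1 w2 : raag_eq w1 w2 -> raag_eq w2 w1
| req_trans w1 w2 w3 : raag_eq w1 w2 -> raag_eq w2 w3 -> raag_eq w1 w3
| req_free a b x : raag_eq (a ++ [:: x; linv x] ++ b) (a ++ b)
| req_rel a b u v : e u v -> raag_eq (a ++ commw u v ++ b) (a ++ b).

End Graphs.

Definition wsubst (D H : sgraph) (f : vert D -> word H) (w : word D) : word H :=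
  flatten (map (fun x : letter D => if x.2 then winv (f x.1) else f x.1) w).

(* f defines a homomorphism G(D) -> G(H): all defining relators map to 1 *)
Definition is_raag_hom (D H : sgraph) (f : vert D -> word H) : Prop :=
  forall u v : vert D, adj u v -> raag_eq (wsubst f (commw u v)) [::].

Definition raag_embeds (D H : sgraph) : Prop :=
  exists f : vert D -> word H, is_raag_hom f /\
    forall w : word D, raag_eq (wsubst f w) [::] -> raag_eq w [::].

Definition graph_iso (D H : sgraph) : Prop :=
  exists f : vert D -> vert H, bijective f /\
    forall x y : vert D, adj (f x) (f y) = adj x y.

(* Main.v *)
From HB Require Import structures.
Require Import Defs.
From mathcomp Require Import all_boot boolp.

(** Equality in the group G(Gamma) is decided by reduced words up to shuffling
of commuting letters.  The Cayley graph is then cut into half-spaces by walls: the wall dual to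
the edge [(1, a)] separates the elements having a reduced word starting with [a] from the others,
and every edge crossing it is a translate of that edge by an element of [<lk a>].

Vertices of the extension graph Gamma^e are the conjugates of generators, adjacent when they
commute.  As Gamma has no cycle of length less than 5, an element whose centralizer contains a free
group of rank 2 is a power of such a vertex; hence an embedding G(Delta) -> G(Gamma) induces a
graph embedding phi : Delta^e -> Gamma^e, equivariant under conjugation.  Two distinct vertices
have at most one common neighbour, and the star of a vertex omega of Gamma^e separates the vertices
lying on the two sides of a wall dual to omega.  Since Delta is atomic, if phi(Delta) is not
contained in a translate of Gamma then it is separated by the star of some omega outside
phi(Delta), which is a common neighbour of two vertices of phi(Delta).

The set of pairs of vertices of Delta whose images acquire a common neighbour can only grow under
composition.  A self-map psi of Delta^e for which it is largest maps Delta into one translate of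
Delta, so this set never grows under self-maps of Delta^e.  Applied to
Delta -> Gamma^e -> Delta^e this excludes omega, so Delta is an induced subgraph of Gamma, and
conversely. *)

Set Implicit Arguments.
Unset Strict Implicit.
Unset Printing Implicit Defensive.
Local Open Scope quotient_scope.
Local Open Scope group_scope.

(** * Reduced words and shuffles *)

Section Words.
Variable G : sgraph.
Local Notation word := (word G).
Local Notation letter := (letter G).
Implicit Types (a b c x y : letter) (u v w : word).

Lemma linvK : involutive (@linv G).
Proof. by case=> v e; rewrite /linv /= negbK. Qed.

Lemma linv_neq a : linv a != a.
Proof. by apply/eqP; case: a => v [] []. Qed.

(* [pull b w] commutes an occurrence of [b] to the front of [w] and removes it. *)
Fixpoint pull b w : option word :=
  if w is c :: w' then
    if c == b then Some w'
    else if adj b.1 c.1 then omap (cons c) (pull b w') else None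
  else None.

Fixpoint reduced w : bool :=
  if w is b :: w' then ~~ pull (linv b) w' && reduced w' else true.

Definition lmul a w := if pull (linv a) w is Some w' then w' else a :: w.

Inductive shuffle : word -> word -> Prop :=
| shuffle_refl w : shuffle w w
| shuffle_step u v x y w : adj x.1 y.1 ->
    shuffle (u ++ y :: x :: v) w -> shuffle (u ++ x :: y :: v) w.

Lemma shuffle_trans w1 w2 w3 : shuffle w1 w2 -> shuffle w2 w3 -> shuffle w1 w3.
Proof.
by elim=> [//|u v x y w xy _ IH] /IH; apply: shuffle_step.
Qed.

Lemma shuffle_sym w1 w2 : shuffle w1 w2 -> shuffle w2 w1.
Proof.
elim=> [w|u v x y w xy _ IH]; first exact: shuffle_refl.
apply: shuffle_trans IH _; apply: shuffle_step; first by rewrite adj_sym.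
exact: shuffle_refl.
Qed.

Lemma shuffle_cat u v w1 w2 : shuffle w1 w2 -> shuffle (u ++ w1 ++ v) (u ++ w2 ++ v).
Proof.
elim=> [w|u' v' x y w xy _ IH]; first exact: shuffle_refl.
rewrite -catA catA; apply: shuffle_step => //.
by move: IH; rewrite -!catA.
Qed.

Lemma shuffle_cons c w1 w2 : shuffle w1 w2 -> shuffle (c :: w1) (c :: w2).
Proof. by move=> /(shuffle_cat [:: c] [::]); rewrite !cats0. Qed.

Lemma shuffle_perm w1 w2 : shuffle w1 w2 -> perm_eq w1 w2.
Proof.
elim=> [w //|u v x y w _ _]; apply: perm_trans.
by rewrite perm_cat2l (perm_catCA [:: x] [:: y] v).
Qed.

Lemma shuffle_swap x y w : adj x.1 y.1 -> shuffle (x :: y :: w) (y :: x :: w).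
Proof. by move=> xy; apply: (@shuffle_step [::]) => //; apply: shuffle_refl. Qed.

Definition oshuffle (o1 o2 : option word) : Prop :=
  match o1, o2 with
  | Some w1, Some w2 => shuffle w1 w2
  | None, None => True
  | _, _ => False
  end.

Lemma oshuffle_refl o : oshuffle o o.
Proof. by case: o => //= w; apply: shuffle_refl. Qed.

Lemma oshuffle_trans o1 o2 o3 : oshuffle o1 o2 -> oshuffle o2 o3 -> oshuffle o1 o3.
Proof. by case: o1 o2 o3 => [w1|] [w2|] [w3|] //=; apply: shuffle_trans. Qed.

Lemma oshuffle_isSome o1 o2 : oshuffle o1 o2 -> isSome o1 = isSome o2.
Proof. by case: o1 o2 => [w1|] [w2|]. Qed.

Lemma adj_neq x y : adj x.1 y.1 -> (x == y) = false.
Proof. by move=> xy; apply/eqP=> e; rewrite e adj_irr in xy. Qed.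

Lemma pull_cons_adj b c w : adj b.1 c.1 -> pull b (c :: w) = omap (cons c) (pull b w).
Proof. by move=> bc /=; rewrite bc eq_sym (adj_neq bc). Qed.

(** An occurrence of [b] can be pulled when it commutes with everything before it, and swaps of
    commuting letters preserve this. Hence reducedness and [lmul] descend to shuffle classes. *)
Lemma pull_shuffle b w1 w2 : shuffle w1 w2 -> oshuffle (pull b w1) (pull b w2).
Proof.
elim=> [w|u v x y w xy _]; first exact: oshuffle_refl.
apply: oshuffle_trans; elim: u => [|c u IH] /=.
  have yx : adj y.1 x.1 by rewrite adj_sym.
  case: (eqVneq x b) => [<-|nx].
    by rewrite xy (adj_neq yx) /=; apply: shuffle_refl.
  case: (eqVneq y b) => [<-|ny].
    by rewrite yx /=; apply: shuffle_refl.
  case: (adj b.1 x.1); case: (adj b.1 y.1) => //=.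
  by case: (pull b v) => //= ? ; apply: shuffle_swap.
case: (c == b); first by apply: shuffle_step => //; apply: shuffle_refl.
case: (adj b.1 c.1) => //.
by case: (pull b _) IH => [?|]; case: (pull b _) => //= ? ; apply: shuffle_cons.
Qed.

Lemma pull_Some b w w' : pull b w = Some w' -> shuffle w (b :: w').
Proof.
elim: w w' => [//|c w IH] w' /=; case: eqP => [->[->]|_]; first exact: shuffle_refl.
case bc: (adj b.1 c.1) => //; case: (pull b w) IH => //= w1 /(_ _ erefl) IH [<-].
apply: shuffle_trans (shuffle_cons c IH) _.
by apply: shuffle_swap; rewrite adj_sym.
Qed.

Lemma pull_head b w : pull b (b :: w) = Some w.
Proof. by rewrite /= eqxx. Qed.

Lemma reduced_cons b w : reduced (b :: w) = ~~ pull (linv b) w && reduced w.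
Proof. by []. Qed.

Lemma reduced_shuffle w1 w2 : shuffle w1 w2 -> reduced w1 = reduced w2.
Proof.
elim=> [//|u v x y w xy _ <-]; elim: u => [|c u IH].
  have yx : adj y.1 x.1 by rewrite adj_sym.
  rewrite !reduced_cons !pull_cons_adj //.
  by case: (pull (linv x) v); case: (pull (linv y) v).
rewrite /= IH; congr (~~ _ && _); apply: oshuffle_isSome; apply: pull_shuffle.
by apply: shuffle_step => //; apply: shuffle_refl.
Qed.

Lemma pull_reduced b w w' : reduced w -> pull b w = Some w' ->
  reduced w' /\ pull (linv b) w' = None.
Proof.
move=> rw /pull_Some /reduced_shuffle; rewrite rw /= => /esym/andP[].
by case: (pull _ w').
Qed.

Lemma lmul_reduced a w : reduced w -> reduced (lmul a w).
Proof.
move=> rw; rewrite /lmul; case E: (pull _ _) => [w'|] /=.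
  by case: (pull_reduced rw E).
by rewrite E.
Qed.

Lemma lmul_shuffle a w1 w2 : shuffle w1 w2 -> shuffle (lmul a w1) (lmul a w2).
Proof.
move=> s; have := pull_shuffle (linv a) s; rewrite /lmul.
by case: (pull _ w1); case: (pull _ w2) => //= _; apply: shuffle_cons.
Qed.

Lemma lmulK a w : reduced w -> shuffle (lmul a (lmul (linv a) w)) w.
Proof.
move=> rw; rewrite {2}/lmul linvK; case E: (pull _ w) => [w'|].
  have [_ n] := pull_reduced rw E; rewrite /lmul n.
  by apply: shuffle_sym; apply: pull_Some.
by rewrite /lmul pull_head; apply: shuffle_refl.
Qed.

Lemma lmulC a b w : adj a.1 b.1 -> shuffle (lmul a (lmul b w)) (lmul b (lmul a w)).
Proof.
move=> ab; have ba : adj b.1 a.1 by rewrite adj_sym.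
have half : forall a b, adj a.1 b.1 -> forall w', pull (linv b) w = Some w' ->
    shuffle (lmul a w') (lmul b (lmul a w)).
  move=> {ab ba b}a b ab w' E; have ba : adj b.1 a.1 by rewrite adj_sym.
  have := pull_shuffle (linv a) (pull_Some E); rewrite pull_cons_adj //.
  rewrite /lmul; case Ea: (pull _ w) => [w1|]; case Ea': (pull _ w') => [w2|] //=.
    move=> s; have := pull_shuffle (linv b) s; rewrite pull_head.
    by case: (pull _ w1) => //= w3 /shuffle_sym.
  by move=> _; rewrite eq_sym (adj_neq (x := linv b)) // ba E /=; apply: shuffle_refl.
case Eb: (pull (linv b) w) => [w'|]; first by rewrite {2}/lmul Eb; apply: half.
case Ea: (pull (linv a) w) => [w'|].
  by rewrite {4}/lmul Ea; apply: shuffle_sym; apply: half.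
rewrite /lmul Ea Eb !pull_cons_adj //= Ea Eb /=.
exact: shuffle_swap.
Qed.

Definition lmulw w z := foldr lmul z w.

Lemma lmulw_reduced w z : reduced z -> reduced (lmulw w z).
Proof. by move=> rz; elim: w => //= a w; apply: lmul_reduced. Qed.

Lemma lmulw_shuffle w z1 z2 : shuffle z1 z2 -> shuffle (lmulw w z1) (lmulw w z2).
Proof. by move=> s; elim: w => //= a w; apply: lmul_shuffle. Qed.

Lemma lmulw_cat w1 w2 z : lmulw (w1 ++ w2) z = lmulw w1 (lmulw w2 z).
Proof. exact: foldr_cat. Qed.

(** Van der Waerden's argument: [lmul] makes the group act on shuffle classes of reduced words.
    Acting on the empty word then solves the word problem. *)
Lemma raag_eq_lmulw w1 w2 z : raag_eq w1 w2 -> reduced z ->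
  shuffle (lmulw w1 z) (lmulw w2 z).
Proof.
move=> E rz; elim: E => {w1 w2}.
- by move=> w; apply: shuffle_refl.
- by move=> w1 w2 _; apply: shuffle_sym.
- by move=> w1 w2 w3 _ s12 _; apply: shuffle_trans.
- move=> u v x; rewrite !lmulw_cat; apply: lmulw_shuffle.
  exact/lmulK/lmulw_reduced.
- move=> u v x y xy; rewrite !lmulw_cat; apply: lmulw_shuffle.
  have rz' : reduced (lmulw v z) by apply: lmulw_reduced.
  move: (lmulw v z) rz' => t rt /=.
  have yx : adj (y, false).1 (x, true).1 by rewrite adj_sym.
  apply: shuffle_trans (lmul_shuffle _ (lmulC _ yx)) _.
  apply: shuffle_trans (lmulK _ _) (lmulK (y, false) rt).
  by do 2!apply: lmul_reduced.
Qed.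
End Words.

(** * The right-angled Artin group as a quotient of words *)

Section RaagEq.
Variable G : sgraph.
Implicit Types (u v w : word G).

Lemma raag_eq_cat u v w1 w2 : raag_eq w1 w2 -> raag_eq (u ++ w1 ++ v) (u ++ w2 ++ v).
Proof.
elim=> {w1 w2}.
- by move=> w; apply: req_refl.
- by move=> w1 w2 _; apply: req_sym.
- by move=> w1 w2 w3 _ s12 _; apply: req_trans.
- by move=> a b x; have := req_free (u ++ a) (b ++ v) x; rewrite -!catA.
- by move=> a b x y xy; have := req_rel (u ++ a) (b ++ v) xy; rewrite -!catA.
Qed.

Lemma raag_eq_mul u1 u2 w1 w2 :
  raag_eq u1 u2 -> raag_eq w1 w2 -> raag_eq (u1 ++ w1) (u2 ++ w2).
Proof.
move=> /(raag_eq_cat [::] w1) /= e1 /(raag_eq_cat u2 [::]); rewrite !cats0.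
exact: req_trans.
Qed.

Lemma winv_cat u v : winv (u ++ v) = winv v ++ winv u.
Proof. by rewrite /winv map_cat rev_cat. Qed.

Lemma winvK : involutive (@winv G).
Proof.
by move=> w; rewrite /winv map_rev revK -map_comp map_id_in // => x _ /=; apply: linvK.
Qed.

Lemma raag_eq_winv w1 w2 : raag_eq w1 w2 -> raag_eq (winv w1) (winv w2).
Proof.
elim=> {w1 w2}.
- by move=> w; apply: req_refl.
- by move=> w1 w2 _; apply: req_sym.
- by move=> w1 w2 w3 _ s12 _; apply: req_trans.
- move=> a b x; rewrite !winv_cat -catA {2}/winv /= /rev /= linvK.
  exact: req_free.
- move=> a b x y xy; rewrite !winv_cat -catA; apply: req_rel.
  by rewrite adj_sym.
Qed.

Lemma raag_eq_mulV w : raag_eq (w ++ winv w) [::].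
Proof.
elim/last_ind: w => [|w x IH]; first exact: req_refl.
rewrite -cats1 winv_cat -catA; apply: req_trans IH.
exact: req_free.
Qed.

Definition raag_eqb : rel (word G) := fun w1 w2 => `[< raag_eq w1 w2 >].

Lemma raag_eqb_equiv : equiv_class_of raag_eqb.
Proof.
split.
- by move=> w; apply/asboolP/req_refl.
- by move=> w1 w2; apply/asboolP/asboolP; apply: req_sym.
- by move=> w1 w2 w3 /asboolP e1 /asboolP e2; apply/asboolP/(req_trans e1).
Qed.

Canonical raag_equiv := EquivRelPack raag_eqb_equiv.
End RaagEq.

Definition raag (G : sgraph) := {eq_quot @raag_equiv G}.
HB.instance Definition _ (G : sgraph) := Choice.on (raag G).

Section RaagGroup.
Variable G : sgraph.
Implicit Types (u v w : word G) (g h : raag G).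

Definition cls w : raag G := \pi w.

Lemma clsP w1 w2 : cls w1 = cls w2 <-> raag_eq w1 w2.
Proof.
rewrite /cls; split=> [/eqmodP/asboolP //|e]; apply/eqmodP; exact/asboolP.
Qed.

Lemma cls_repr g : cls (repr g) = g.
Proof. exact: reprK. Qed.

Lemma raag_eq_repr w : raag_eq (repr (cls w)) w.
Proof. by apply/clsP; rewrite cls_repr. Qed.

Definition raag_mul g h := cls (repr g ++ repr h).
Definition raag_one := cls [::].
Definition raag_inv g := cls (winv (repr g)).

Fact raag_mulE u v : raag_mul (cls u) (cls v) = cls (u ++ v).
Proof. by apply/clsP; apply: raag_eq_mul; apply: raag_eq_repr. Qed.

Fact raag_invE u : raag_inv (cls u) = cls (winv u).
Proof. by apply/clsP; apply: raag_eq_winv; apply: raag_eq_repr. Qed.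

Fact raag_mulA : associative raag_mul.
Proof.
by move=> x y z; rewrite -[x]cls_repr -[y]cls_repr -[z]cls_repr !raag_mulE catA.
Qed.

Fact raag_mul1g : left_id raag_one raag_mul.
Proof. by move=> x; rewrite -[x]cls_repr raag_mulE. Qed.

Fact raag_mulg1 : right_id raag_one raag_mul.
Proof. by move=> x; rewrite -[x]cls_repr raag_mulE cats0. Qed.

Fact raag_mulgV : right_inverse raag_one raag_inv raag_mul.
Proof.
move=> x; rewrite -[x]cls_repr raag_invE raag_mulE; apply/clsP.
exact: raag_eq_mulV.
Qed.

Fact raag_mulVg : left_inverse raag_one raag_inv raag_mul.
Proof.
move=> x; rewrite -[x]cls_repr raag_invE raag_mulE; apply/clsP.
by rewrite -{2}[repr x]winvK; apply: raag_eq_mulV.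
Qed.

HB.instance Definition _ := isGroup.Build (raag G)
  raag_mulA raag_mul1g raag_mulg1 raag_mulVg raag_mulgV.

Lemma cls_cat u v : cls (u ++ v) = cls u * cls v.
Proof. by rewrite -raag_mulE. Qed.

Lemma cls_nil : cls [::] = 1.
Proof. by []. Qed.

Lemma cls_winv u : cls (winv u) = (cls u)^-1.
Proof. by rewrite -raag_invE. Qed.

Definition lgen (a : letter G) : raag G := cls [:: a].
Definition gv (v : vert G) : raag G := lgen (v, false).

Lemma cls_cons a w : cls (a :: w) = lgen a * cls w.
Proof. by rewrite -cls_cat. Qed.

Lemma lgen_linv a : lgen (linv a) = (lgen a)^-1.
Proof. by rewrite -cls_winv. Qed.

Lemma lgenE (v : vert G) e : lgen (v, e) = if e then (gv v)^-1 else gv v.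
Proof. by case: e => //; rewrite -lgen_linv. Qed.

Lemma gv_comm (u v : vert G) : adj u v -> commute (gv u) (gv v).
Proof.
move=> uv; have /clsP := req_rel [::] [::] uv.
rewrite cat0s cats0 !cls_cons !lgenE cls_nil mulg1 => e.
by apply: (mulIg (gv u)^-1); apply: (mulIg (gv v)^-1); rewrite mulgK mulgV -!mulgA.
Qed.

Lemma lgen_comm a b : adj a.1 b.1 -> commute (lgen a) (lgen b).
Proof.
case: a b => [u e] [v f] /= uv; rewrite !lgenE.
have c := gv_comm uv; case: e; case: f => //.
- by apply: commuteV; apply/commute_sym; apply: commuteV; apply/commute_sym.
- by apply/commute_sym; apply: commuteV; apply/commute_sym.
- exact: commuteV.
Qed.

Lemma shuffle_cls w1 w2 : shuffle w1 w2 -> cls w1 = cls w2.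
Proof.
elim=> // u v x y w xy _ <-; rewrite !cls_cat !cls_cons; congr (_ * _).
by rewrite !mulgA (lgen_comm xy).
Qed.

Lemma pull_cls b w w' : pull b w = Some w' -> cls w = lgen b * cls w'.
Proof. by move/pull_Some/shuffle_cls; rewrite cls_cons. Qed.

Lemma lmul_cls a w : cls (lmul a w) = lgen a * cls w.
Proof.
rewrite /lmul; case E: (pull _ _) => [w'|]; last by rewrite cls_cons.
by rewrite (pull_cls E) lgen_linv mulVKg.
Qed.

Definition nf g := lmulw (repr g) [::].

Lemma nf_reduced g : reduced (nf g).
Proof. exact: lmulw_reduced. Qed.

Lemma lmulw_cls w : cls (lmulw w [::]) = cls w.
Proof. by elim: w => //= a w IH; rewrite lmul_cls IH -cls_cons. Qed.

Lemma nfK g : cls (nf g) = g.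
Proof. by rewrite lmulw_cls cls_repr. Qed.

Lemma lmulw_id w : reduced w -> lmulw w [::] = w.
Proof.
elim: w => //= a w IH /andP[n /IH ->]; rewrite /lmul.
by case: (pull _ _) n.
Qed.

Lemma reduced_cls w1 w2 : reduced w1 -> reduced w2 -> cls w1 = cls w2 -> shuffle w1 w2.
Proof.
move=> r1 r2 /clsP /raag_eq_lmulw /(_ (isT : reduced [::])).
by rewrite !lmulw_id.
Qed.

Lemma nf_cls w : reduced w -> shuffle (nf (cls w)) w.
Proof. by move=> rw; apply: reduced_cls; rewrite ?nf_reduced ?nfK. Qed.

End RaagGroup.

Lemma ex_min_measure T (P : T -> Prop) (f : T -> nat) :
  (exists x, P x) -> exists2 x, P x & forall y, P y -> f x <= f y.
Proof.
case=> x Px; have [n] := ubnP (f x); elim: n x Px => // n IH x Px lt.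
have [[y [Py yx]]|no] := pselect (exists y, P y /\ f y < f x).
  by apply: IH Py _; apply: leq_trans yx _.
exists x => // y Py; rewrite leqNgt; apply/negP=> yx; apply: no; by exists y.
Qed.

Lemma ex_max_measure T (P : T -> Prop) (f : T -> nat) (M : nat) :
  (forall x, f x <= M) -> (exists x, P x) -> exists2 x, P x & forall y, P y -> f y <= f x.
Proof.
move=> fM /(@ex_min_measure _ _ (fun x => M - f x))[x Px xmin]; exists x => // y Py.
by have := xmin y Py; rewrite leq_sub2lE.
Qed.

(** * Length, support and wall crossings *)

Section Length.
Variable G : sgraph.
Implicit Types (a b c : letter G) (u v w : word G) (g h p q : raag G) (A B : pred (vert G)).

Definition adjall c w := all (fun d => adj c.1 d.1) w.
Definition suppw A w := all (fun d : letter G => A d.1) w.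

Lemma pull_cat b w1 w2 : pull b (w1 ++ w2) =
  if pull b w1 is Some w' then Some (w' ++ w2)
  else if adjall b w1 then omap (cat w1) (pull b w2) else None.
Proof.
elim: w1 => [|c w1 IH] /=; first by case: (pull b w2).
case: eqP => // _; case: (adj b.1 c.1) => //=; rewrite IH.
by case: (pull b w1) => //=; case: (adjall b w1) => //; case: (pull b w2).
Qed.

Lemma reduced_cat w1 w2 : reduced (w1 ++ w2) -> reduced w1 /\ reduced w2.
Proof.
elim: w1 => //= c w1 IH /andP[n /IH[r1 r2]]; split=> //; rewrite r1 andbT.
by move: n; rewrite pull_cat; case: (pull _ w1).
Qed.

(** Each factor is reduced, so a cancelling pair straddles the seam and its left letter [c] commutes
    past the end [v] of the first factor. *)
Lemma not_reduced_cat w1 w2 : reduced w1 -> reduced w2 -> ~~ reduced (w1 ++ w2) ->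
  exists c u v, [/\ w1 = u ++ c :: v, adjall c v & pull (linv c) w2].
Proof.
elim: w1 => [|c w1 IH] /=; first by move=> _ ->.
move=> /andP[n r1] r2; rewrite negb_and negbK => /orP[|nr]; last first.
  by have [d [u [v [-> vd pd]]]] := IH r1 r2 nr; exists d, (c :: u), v.
move: n; rewrite pull_cat; case: (pull _ w1) => //= _.
case E: (adjall _ w1) => //; case F: (pull _ w2) => // _.
by exists c, [::], w1; split=> //; rewrite F.
Qed.

Lemma adjall_shuffle c v : adjall c v -> shuffle (c :: v) (v ++ [:: c]).
Proof.
elim: v => [_|d v IH /= /andP[cd /IH s]]; first exact: shuffle_refl.
exact: shuffle_trans (shuffle_swap _ cd) (shuffle_cons _ s).
Qed.

Definition start a g : bool := pull a (nf g).
(** Membership in the standard parabolic subgroup generated by [A], read off from a normal form. *)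
Definition sub A g := suppw A (nf g).
Definition len g := size (nf g).

Lemma start_cls a w : reduced w -> start a (cls w) = pull a w.
Proof. by move=> rw; apply: oshuffle_isSome; apply: pull_shuffle; apply: nf_cls. Qed.

Lemma sub_cls A w : reduced w -> sub A (cls w) = suppw A w.
Proof. by move=> rw; apply: perm_all; apply: shuffle_perm; apply: nf_cls. Qed.

Lemma len_cls w : reduced w -> len (cls w) = size w.
Proof. by move=> rw; apply: perm_size; apply: shuffle_perm; apply: nf_cls. Qed.

Lemma pull_perm b w w' : pull b w = Some w' -> perm_eq w (b :: w').
Proof. by move=> /pull_Some; apply: shuffle_perm. Qed.

Lemma lmulw_suppw A w : suppw A w -> suppw A (lmulw w [::]).
Proof.
elim: w => //= a w IH /andP[Aa /IH]; rewrite /lmul.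
case E: (pull _ _) => [w'|]; last by rewrite /= Aa.
by rewrite /suppw (perm_all _ (pull_perm E)) /= => /andP[].
Qed.

Lemma sub_word A w : suppw A w -> sub A (cls w).
Proof.
by move=> Aw; rewrite -lmulw_cls sub_cls ?lmulw_reduced //; apply: lmulw_suppw.
Qed.

Lemma subM A g h : sub A g -> sub A h -> sub A (g * h).
Proof.
move=> Ag Ah; rewrite -[g]nfK -[h]nfK -cls_cat; apply: sub_word.
by rewrite /suppw all_cat; apply/andP.
Qed.

Lemma suppw_winv A w : suppw A (winv w) = suppw A w.
Proof. by rewrite /suppw /winv all_rev all_map. Qed.

Lemma subV A g : sub A g -> sub A g^-1.
Proof. by move=> Ag; rewrite -[g]nfK -cls_winv; apply: sub_word; rewrite suppw_winv. Qed.

Lemma sub1 A : sub A 1.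
Proof. exact: (@sub_word _ [::]). Qed.

Lemma subX A g n : sub A g -> sub A (g ^+ n).
Proof.
by move=> Ag; elim: n => [|n IH]; rewrite ?expg0 ?sub1 // expgS; apply: subM.
Qed.

Lemma sub_lgen A a : sub A (lgen a) = A a.1.
Proof. by rewrite sub_cls //= andbT. Qed.

Lemma subS A B g : (forall x, A x -> B x) -> sub A g -> sub B g.
Proof. by move=> AB; apply: sub_all => x /AB. Qed.

Lemma subI A B g : sub A g -> sub B g -> sub (predI A B) g.
Proof. by move=> Ag Bg; rewrite /sub /suppw /= all_predI; apply/andP. Qed.

Lemma commute_cls w1 w2 :
  {in w1 & w2, forall a b, commute (lgen a) (lgen b)} -> commute (cls w1) (cls w2).
Proof.
elim: w1 => [|a w1 IH] c12; first exact/commute_sym/commute1.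
rewrite cls_cons; apply/commute_sym/commuteM; last first.
  by apply/commute_sym/IH => x y xw; apply: c12; rewrite inE xw orbT.
have {IH} : {in w2, forall b, commute (lgen a) (lgen b)}.
  by move=> b bw; apply: c12 => //; rewrite mem_head.
elim: w2 {c12} => [|b w2 IH] c2; first exact/commute_sym/commute1.
rewrite cls_cons; apply/commute_sym/commuteM; first by apply: c2; rewrite mem_head.
by apply/commute_sym/IH => x xw; apply: c2; rewrite inE xw orbT.
Qed.

Lemma lgen_comm_eq a b : a.1 = b.1 -> commute (lgen a) (lgen b).
Proof.
case: a b => [u e] [v f] /= ->; rewrite !lgenE; have c := commute_refl (gv v).
by case: e; case: f => //; [apply/commute_sym|]; apply: commuteV.
Qed.

Lemma sub_commute A B p q : (forall x y, A x -> B y -> x = y \/ adj x y) ->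
  sub A p -> sub B q -> commute p q.
Proof.
move=> AB /allP Ap /allP Bq; rewrite -[p]nfK -[q]nfK; apply: commute_cls => a b /Ap Aa /Bq Bb.
by case: (AB a.1 b.1 Aa Bb); [apply: lgen_comm_eq | apply: lgen_comm].
Qed.

Lemma len_le w : len (cls w) <= size w.
Proof.
rewrite -lmulw_cls len_cls ?lmulw_reduced //.
elim: w => //= a w IH; rewrite /lmul; case E: (pull _ _) => [w'|] //.
have /perm_size /= e := pull_perm E.
by apply: leq_trans (leq_trans IH (leqnSn _)); rewrite e.
Qed.

Lemma lenM g h : len (g * h) <= len g + len h.
Proof. by rewrite -{1}[g]nfK -{1}[h]nfK -cls_cat (leq_trans (len_le _)) ?size_cat. Qed.

Lemma lenV g : len g^-1 = len g.
Proof.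
have le k : len k^-1 <= len k.
  rewrite -{1}[k]nfK -cls_winv (leq_trans (len_le _)) //.
  by rewrite /winv size_rev size_map.
by apply/eqP; rewrite eqn_leq le -{1}[g]invgK le.
Qed.

Lemma startP a g : start a g -> exists2 w, reduced (a :: w) & g = cls (a :: w).
Proof.
rewrite /start; case E: (pull a (nf g)) => [w|] // _.
have s := pull_Some E; exists w; last by rewrite -(shuffle_cls s) nfK.
by rewrite -(reduced_shuffle s) nf_reduced.
Qed.

Lemma start_len a g : start a g -> len g = (len ((lgen a)^-1 * g)).+1.
Proof.
case/startP=> w rw ->; rewrite cls_cons mulKg -cls_cons !len_cls //.
by move: rw => /andP[].
Qed.

Lemma not_start_len a g : ~~ start a g -> len ((lgen a)^-1 * g) = (len g).+1.
Proof.
move=> ns; rewrite -lgen_linv -{1}[g]nfK -cls_cons len_cls // reduced_cons linvK.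
by rewrite nf_reduced andbT.
Qed.

Lemma start1 a : start a 1 = false.
Proof. by rewrite start_cls. Qed.

Lemma len_gt0 g : g <> 1 -> exists a, start a g.
Proof.
move=> n1; case E: (nf g) => [|a w]; first by case: n1; rewrite -[g]nfK E.
by exists a; rewrite /start E pull_head.
Qed.

Lemma start_sub A a g : start a g -> sub A g -> A a.1.
Proof. by case/startP=> w rw ->; rewrite sub_cls // => /andP[]. Qed.

(* An edge [(g, g b)] of the Cayley graph crosses the wall dual to the edge [(1, a)] only if
   it is parallel to it. *)
Lemma cross_step a b g : ~~ start a g -> start a (g * lgen b) ->
  b = a /\ sub (adj a.1) g.
Proof.
move=> ns; rewrite -[g]nfK -cls_cat; have rw := nf_reduced g.
case R: (reduced (nf g ++ [:: b])).
  rewrite start_cls // pull_cat; move: ns; rewrite /start; case: (pull a _) => //= _.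
  case E: (adjall a _) => //; case: eqP => [-> _|_]; last by case: ifP.
  by split=> //; rewrite nfK.
have [//|//|c [u [v [wE cv]]]] := @not_reduced_cat (nf g) [:: b] _ _ (negbT R).
rewrite /=; case: eqP => [bE _|_]; last by case: ifP.
have s : shuffle (nf g) ((u ++ v) ++ [:: c]).
  rewrite wE -catA; have := shuffle_cat u [::] (adjall_shuffle cv).
  by rewrite !cats0.
have /reduced_cat[ruv _] : reduced ((u ++ v) ++ [:: c]) by rewrite -(reduced_shuffle s).
have -> : cls (nf g ++ [:: b]) = cls (u ++ v).
  by rewrite cls_cat (shuffle_cls s) cls_cat bE -/(lgen _) -/(lgen _) lgen_linv mulgK.
rewrite start_cls // => p; case/negP: ns; rewrite /start.
rewrite (oshuffle_isSome (pull_shuffle a s)) pull_cat.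
by case: (pull a _) p.
Qed.

Lemma cross_up a g w : ~~ start a g -> start a (g * cls w) ->
  exists w1 w2, w = w1 ++ a :: w2 /\ sub (adj a.1) (g * cls w1).
Proof.
elim: w g => [|b w IH] g ns; first by rewrite mulg1 (negbTE ns).
rewrite cls_cons mulgA; case S: (start a (g * lgen b)) => p.
  have [-> sg] := cross_step ns S; exists [::], w; by rewrite mulg1.
have [w1 [w2 [-> sg]]] := IH _ (negbT S) p; exists (b :: w1), w2; split=> //.
by rewrite cls_cons mulgA.
Qed.

Lemma cross_down a g w : start a g -> ~~ start a (g * cls w) ->
  exists w1 w2, w = w1 ++ linv a :: w2 /\ sub (adj a.1) (g * cls w1 * (lgen a)^-1).
Proof.
elim: w g => [|b w IH] g ns; first by rewrite mulg1 ns.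
rewrite cls_cons mulgA; case S: (start a (g * lgen b)) => p; last first.
  have ns' : start a (g * lgen b * lgen (linv b)) by rewrite lgen_linv mulgK.
  have [e sg] := cross_step (negbT S) ns'.
  exists [::], w; split; first by rewrite -e linvK.
  by rewrite cls_nil mulg1 -lgen_linv -{2}e linvK.
have [w1 [w2 [-> sg]]] := IH _ S p; exists (b :: w1), w2; split=> //.
by rewrite cls_cons mulgA.
Qed.

(** A letter of [m] cancelling against the subgroup on [A] would give a shorter element of the same
    coset. *)
Lemma minr_reduced A m t : (forall s, sub A s -> len m <= len (m * s)) -> sub A t ->
  reduced (nf m ++ nf t).
Proof.
move=> mmin At; apply: contraT => /not_reduced_cat[||c [u [v [mE cv pc]]]]; rewrite ?nf_reduced //.
have Ac : A c.1 by have /= := start_sub (pc : start _ t) At.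
have := mmin (lgen (linv c)); rewrite sub_lgen => /(_ Ac).
rewrite -{2}[m]nfK mE; have := shuffle_cat u [::] (adjall_shuffle cv).
rewrite !cats0 => /shuffle_cls ->; rewrite catA cls_cat lgen_linv -/(lgen c) mulgK => le.
by have := leq_trans le (len_le _); rewrite /len mE !size_cat /= addnS ltnn.
Qed.

Lemma minl_reduced A m t : (forall s, sub A s -> len m <= len (s * m)) -> sub A t ->
  reduced (nf t ++ nf m).
Proof.
move=> mmin At; apply: contraT => /not_reduced_cat[||c [u [v [tE cv pc]]]]; rewrite ?nf_reduced //.
have Ac : A c.1 by move: At; rewrite /sub tE /suppw all_cat /= => /and3P[].
have := mmin (lgen c); rewrite sub_lgen => /(_ Ac).
have := start_len (pc : start (linv c) m); rewrite lgen_linv invgK => ->.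
by rewrite ltnn.
Qed.

(** The exponent of [u] modulo 2 is a conjugation-invariant homomorphism; it recovers a generator
    from any of its conjugates. *)
Definition parw (u : vert G) w := odd (count (fun a : letter G => a.1 == u) w).

Lemma parw_eq (u : vert G) w1 w2 : raag_eq w1 w2 -> parw u w1 = parw u w2.
Proof.
rewrite /parw; elim=> // {w1 w2}.
- by move=> w1 w2 w3 _ ->.
- by move=> w1 w2 x; rewrite !count_cat /= addn0 addnn !oddD odd_double.
- move=> w1 w2 x y _; rewrite !count_cat /= addn0 !oddD !oddb.
  by case: (x == u); case: (y == u).
Qed.

Definition par (u : vert G) g := parw u (repr g).

Lemma par_cls (u : vert G) w : par u (cls w) = parw u w.
Proof. exact/parw_eq/raag_eq_repr. Qed.

Lemma parM (u : vert G) g h : par u (g * h) = par u g (+) par u h.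
Proof. by rewrite -[g]nfK -[h]nfK -cls_cat !par_cls /parw count_cat oddD. Qed.

Lemma parV (u : vert G) g : par u g^-1 = par u g.
Proof. by rewrite -[g]nfK -cls_winv !par_cls /parw /winv count_rev count_map. Qed.

Lemma par_gv (u v : vert G) : par u (gv v) = (v == u).
Proof. by rewrite par_cls /parw /= addn0 oddb. Qed.

Lemma parJ (u : vert G) g h : par u (g ^ h) = par u g.
Proof. by rewrite conjgE !parM parV; case: (par u g); case: (par u h). Qed.

Lemma par_sub A (u : vert G) g : par u g -> sub A g -> A u.
Proof.
rewrite -{1}[g]nfK par_cls /parw /sub; case C: (count _ _) => [//|n] _ /allP s.
have : has (fun a : letter G => a.1 == u) (nf g) by rewrite has_count C.
by case/hasP=> a /s /= Aa /eqP <-.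
Qed.

Lemma gv_conj_inj (u v : vert G) g h : gv u ^ g = gv v ^ h -> u = v.
Proof.
by move/(congr1 (par v)); rewrite !parJ !par_gv eqxx => /eqP.
Qed.

End Length.

Section GroupFacts.
Variable T : groupType.
Implicit Types x y z : T.

Lemma commuteJ x y k : commute (x ^ k) (y ^ k) <-> commute x y.
Proof.
rewrite /commute -!conjMg; split=> [/conjg_inj //|-> //].
Qed.

Lemma commute_conjVr x y k : commute x (y ^ k) <-> commute (x ^ k^-1) y.
Proof. by rewrite -(commuteJ _ y k) conjgKV. Qed.

Lemma commute_conj_id x y : commute y x -> x ^ y = x.
Proof. by move=> c; rewrite conjgE -c mulKg. Qed.

Lemma commute_Xl x y n : commute x y -> commute (x ^+ n) y.
Proof. by move=> c; apply/commute_sym/commuteX/commute_sym. Qed.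

Lemma commute_Ml x y z : commute x z -> commute y z -> commute (x * y) z.
Proof. by move=> c1 c2; apply/commute_sym/commuteM; apply/commute_sym. Qed.

Lemma commute_Vl x y : commute x y -> commute x^-1 y.
Proof. by move=> c; apply/commute_sym/commuteV/commute_sym. Qed.
End GroupFacts.

Lemma pigeonhole n (P : 'I_n.+1 -> 'I_n -> Prop) : (forall i, exists l, P i l) ->
  exists (i j : 'I_n.+1) (l : 'I_n), [/\ i < j, P i l & P j l].
Proof.
case/choice=> f Pf; have /injectivePn[i [j ij fij]] : ~~ injectiveb f.
  by apply/injectiveP=> /leq_card; rewrite !card_ord ltnn.
wlog lt : i j ij fij / i < j.
  move=> H; case: (ltngtP i j) => [lt|lt|e]; first exact: (H i j).
    by apply: (H j i); rewrite // eq_sym.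
  by rewrite (val_inj e) eqxx in ij.
by exists i, j, (f i); split=> //; rewrite fij.
Qed.

(** * Axes, walls and centralizers of generators *)

Section Centralizers.
Variable G : sgraph.
Implicit Types (a b c : letter G) (u v x y : vert G) (w : word G) (g h p q z : raag G).

Definition st v : pred (vert G) := fun x => (x == v) || adj v x.

Lemma st_sym x y : st x y = st y x.
Proof. by rewrite /st eq_sym adj_sym. Qed.

Lemma sub_st_commute v z : sub (st v) z -> commute z (gv v).
Proof.
move=> sz; apply: (sub_commute (A := st v) (B := pred1 v)) => //; last first.
  by rewrite sub_lgen /= eqxx.
by move=> x y /orP[/eqP->|vx] /eqP->; [left|right; rewrite adj_sym].
Qed.

Definition wpow n w := flatten (nseq n w).

Lemma cls_wpow n w : cls (wpow n w) = cls w ^+ n.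
Proof. by elim: n => //= n IH; rewrite cls_cat IH expgS. Qed.

(** A letter of one copy cannot commute past the whole next copy, which contains that letter itself.
    So any cancellation would already occur in [w ++ w]. *)
Lemma wpow_reduced n w : reduced (w ++ w) -> reduced (wpow n w).
Proof.
move=> rww; have [rw _] := reduced_cat rww; elim: n => //= n IH; apply: contraT.
case/(not_reduced_cat rw IH)=> c [u [v [wE cv]]]; case: n {IH} => //= n.
rewrite pull_cat; case P: (pull _ w) => [w'|].
  move: rww; rewrite {1}wE -catA => /reduced_cat[_ /=]; rewrite pull_cat P.
  by rewrite [adjall _ v]cv; case: (pull _ v).
case A: (adjall _ w) => //; move/allP: A => /(_ c).
by rewrite {1}wE mem_cat mem_head orbT /= adj_irr => /(_ isT).
Qed.

Lemma wpow_prefix n w w1 a w2 : wpow n w = w1 ++ a :: w2 ->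
  exists j l, l < size w /\ w1 = wpow j w ++ take l w.
Proof.
elim: n w1 => [[]//|n IH] w1; rewrite -[wpow _ _]/(w ++ wpow n w) => e.
case: (ltnP (size w1) (size w)) => lt.
  exists 0, (size w1); split=> //=.
  by have := congr1 (take (size w1)) e; rewrite take_cat lt take_size_cat.
have e1 : w1 = w ++ drop (size w) w1.
  rewrite -{1}(cat_take_drop (size w) w1); congr (_ ++ _).
  by have := congr1 (take (size w)) e; rewrite take_size_cat // takel_cat.
have [|j [l [lw d]]] := IH (drop (size w) w1).
  have := congr1 (drop (size w)) e; rewrite drop_size_cat // => ->.
  by rewrite {1}e1 -catA drop_size_cat.
by exists j.+1, l; split=> //; rewrite e1 d -catA.
Qed.

(** Otherwise every path from [y i] spelled by the normal form of [p] crosses the wall at one of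
    [len p] places. Two of them cross at the same place, and then [y i * (y j)^-1] stabilises the
    wall. *)
Lemma escape a p (y : nat -> raag G) (s : bool) :
  (forall i j, i < j -> ~ sub (adj a.1) (y i * (y j)^-1)) ->
  (forall i, start a (y i) = s) -> exists i, start a (y i * p) = s.
Proof.
move=> ysep ys; apply: contrapT => /forallNP no.
(* A downward crossing starts beyond the wall; [k] moves to the end of the crossing edge on the side
   of 1. *)
pose k := if s then (lgen a)^-1 else 1.
have [|i [j [l [ij si sj]]]] := @pigeonhole (len p)
    (fun i l => sub (adj a.1) (y i * cls (take l (nf p)) * k)).
  move=> i; have : start a (y i * cls (nf p)) <> s by rewrite nfK.
  have := ys i; rewrite /k.
  have fin w1 w2 b : nf p = w1 ++ b :: w2 -> exists l : 'I_(len p), w1 = take l (nf p).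
    move=> e; have lt : size w1 < len p by rewrite /len e size_cat /= addnS ltnS leq_addr.
    by exists (Ordinal lt); rewrite /= e take_size_cat.
  case: s {k ys no} => si nsi.
    have [//||w1 [w2 [/fin[l ->] sl]]] := @cross_down _ a (y i) (nf p); last by exists l.
    by apply/negP=> h; apply: nsi.
  have [|//|w1 [w2 [/fin[l ->] sl]]] := @cross_up _ a (y i) (nf p).
  - by rewrite si.
  - by apply: contra_notT nsi => /negbTE.
  - by exists l; rewrite mulg1.
apply: (ysep _ _ ij).
by have := subM si (subV sj); rewrite !invgM !mulgA mulgK mulgK.
Qed.

(* The axis of a cyclically reduced element crosses the wall dual to its first letter; since
   [p] commutes with [g], the translate by [p] of that axis crosses it too. *)
Lemma axis_cross a w p (g := cls (a :: w)) : reduced ((a :: w) ++ a :: w) -> commute p g ->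
  exists i j l, l < (size w).+1 /\
    sub (adj a.1) (p * (g ^- i * g ^+ j * cls (take l (a :: w)))).
Proof.
move=> rww pg; have lenX n : len (g ^+ n) = (n * (size w).+1)%N.
  rewrite -cls_wpow len_cls; last exact: wpow_reduced.
  by elim: n => //= n IH; rewrite size_cat IH.
have startX n : start a (g ^+ n.+1).
  by rewrite -cls_wpow start_cls ?wpow_reduced //= eqxx.
have nsub n : ~ sub (adj a.1) (g ^+ n.+1).
  by move/(start_sub (startX n)); rewrite adj_irr.
(* If [g^-n] started with [a], then [g^n a] would be shorter than [g^n], and multiplying by [cls w]
   could not reach the full length of [g^(n+1)]. *)
have nstartV n : start a (g ^- n) = false.
  apply/negP=> /start_len; rewrite lenV -invgM lenV lenX => e.
  have := lenM (g ^+ n * lgen a) (cls w).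
  rewrite -mulgA -cls_cons -expgSr lenX; move: (len_le w); rewrite mulSn e => l1 l2.
  have := leq_trans l2 (leq_add (leqnn _) l1).
  by rewrite addnC addSn addnS ltnNge leqnSn.
(* The positive half of the axis lies beyond the wall and the negative half before it; [p] cannot
   push either half entirely across. *)
have [i j ij|//|N sN] := @escape a p (fun n => g ^+ n.+1) true.
  move/subV; rewrite invgM invgK -expgnFr; last by apply: ltnW.
  by have := subnSK ij; rewrite subSS => <-; apply: nsub.
have [i j ij|//|M sM] := @escape a p (fun n => g ^- n) false.
  rewrite invgK (commute_Vl (commuteX2 i j (commute_refl g))) -expgnFr; last by apply: ltnW.
  by rewrite -(subnSK ij); apply: nsub.
have c n : g ^+ n * p = p * g ^+ n by apply: commute_sym; apply: commuteX.
have cV n : g ^- n * p = p * g ^- n.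
  by apply: commute_sym; apply: commuteV; apply: commuteX.
have [||w1 [w2 [/wpow_prefix[j [l [lw ->]]] sl]]] :=
    @cross_up _ a (p * g ^- M) (wpow (M + N.+1) (a :: w)).
- by rewrite -cV sM.
- by rewrite cls_wpow expgnDr -/g mulgA mulgVK -c.
exists M, j, l; split=> //.
by move: sl; rewrite cls_cat cls_wpow !mulgA.
Qed.

(** Among the translates of the axis by powers of [p], two cross the wall at the same letter of the
    period, so they differ by an element of its stabiliser. The correction [z] is a power of [g],
    recorded only through what commutes with it. *)
Lemma power_fix_wall a w p (g := cls (a :: w)) : reduced ((a :: w) ++ a :: w) -> commute p g ->
  exists i z, [/\ 0 < i, forall q, commute q g -> commute q z & sub (adj a.1) (p ^+ i * z)].
Proof.
move=> rww pg; have [|n [n' [l [lt [i [j s]] [i' [j' s']]]]]] := @pigeonhole (size w).+1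
  (fun n l => exists i j, sub (adj a.1) (p ^+ n * (g ^- i * g ^+ j * cls (take l (a :: w))))).
  move=> n; have [|i [j [l [ls sn]]]] := @axis_cross a w (p ^+ n) rww.
    exact: commute_Xl.
  by exists (Ordinal ls), i, j.
pose z := g ^- i' * g ^+ j' * (g ^- i * g ^+ j)^-1.
have cz q : commute q g -> commute q z.
  by move=> qg; rewrite /z; do !(apply: commuteM || apply: commuteV || apply: commuteX).
exists (n' - n)%N, z; split=> //; first by rewrite subn_gt0.
have := subM s' (subV s); congr (is_true (sub _ _)).
rewrite !invgM !mulgA mulgK -!mulgA; rewrite expgnFr; last exact: ltnW.
rewrite -!mulgA; congr (_ * _).
have /commute_sym e : commute (p ^- n) z by apply: cz; apply: commute_Vl; apply: commute_Xl.
by move: e; rewrite /commute /z !invgM -!mulgA.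
Qed.

Lemma nseq_reduced a n : reduced (nseq n a).
Proof.
elim: n => //= n ->; rewrite andbT; case: n => //= n.
by rewrite adj_irr eq_sym (negbTE (linv_neq a)).
Qed.

Lemma cls_nseq a n : cls (nseq n a) = lgen a ^+ n.
Proof. by elim: n => //= n IH; rewrite cls_cons IH expgS. Qed.

Lemma commute_gvX u n z : 0 < n -> commute z (gv u ^+ n) -> sub (st u) z.
Proof.
case: n => // n _; rewrite /gv -cls_nseq => c.
have [|i [j [l [_ s]]]] := @axis_cross (u, false) (nseq n (u, false)) z _ c.
  by rewrite -[_ :: _]/(nseq n.+1 (u, false)) -nseqD nseq_reduced.
have sw : suppw (st u) (nseq n.+1 (u, false)) by rewrite /suppw all_nseq /st /= eqxx.
move: s; set t := (X in z * X) => s; have st_t : sub (st u) t.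
  apply: subM; last by apply: sub_word; apply/allP=> x /mem_take; apply: (allP sw).
  by apply: subM; [apply: subV|]; apply: subX; apply: sub_word.
rewrite -[z](mulgK t); apply: subM; last exact: subV.
by apply: subS s => x ux; rewrite /st ux orbT.
Qed.

Lemma commute_gv u z : commute z (gv u) <-> sub (st u) z.
Proof. by split; [apply: (@commute_gvX u 1) | apply: sub_st_commute]. Qed.

Lemma commute_gv2 u v : commute (gv u) (gv v) <-> u = v \/ adj u v.
Proof.
rewrite commute_gv sub_lgen /st /= adj_sym; split.
  by case/orP=> [/eqP|]; [left|right].
by case=> [->|->]; rewrite ?eqxx ?orbT.
Qed.

(** If one side were never reached, lengths would decrease forever along the powers of [a]. *)
Lemma start_lgen_pow a g : (exists n, start a (lgen a ^+ n * g)) /\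
  (exists n, ~~ start a (lgen a ^- n * g)).
Proof.
split; apply: contrapT => /forallNP no.
- have e n : len g = (len (lgen a ^+ n * g)%g + n)%N.
    elim: n => [|n ->]; first by rewrite mul1g addn0.
    rewrite -[lgen a ^+ n * g](mulKg (lgen a)) not_start_len ?mulgA -?expgS ?addSnnS //.
    exact/negP.
  by have := leq_addl (len (lgen a ^+ (len g).+1 * g)) (len g).+1; rewrite -e ltnn.
- have e n : len g = (len (lgen a ^- n * g)%g + n)%N.
    elim: n => [|n ->]; first by rewrite invg1 mul1g addn0.
    rewrite (start_len (a := a)); last by have /negP := no n; rewrite negbK.
    by rewrite expgSr invgM mulgA addSnnS.
  by have := leq_addl (len (lgen a ^- (len g).+1 * g)) (len g).+1; rewrite -e ltnn.
Qed.

End Centralizers.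

(** * The extension graph and its common neighbours *)

Section CommutingConjugates.
Variable G : sgraph.
Implicit Types (u v w x y : vert G) (g h k p q z W X Y : raag G).

(** After conjugation, [t = gv v ^ h^-1] lies in the subgroup on [st w]. The points [h^-1 * t^i],
    which are the [gv v ^ i * h^-1], occur on both sides of the wall of [v], so a path between them
    spelled in [st w] crosses it. The crossing point gives the common conjugator. *)
Lemma commute_common_conj v w k h : commute (gv v ^ k) (gv w ^ h) ->
  exists m, [/\ gv v ^ k = gv v ^ m, gv w ^ h = gv w ^ m & v = w \/ adj v w].
Proof.
move=> c; suff [m [e1 e2 vw]] : exists m,
    [/\ gv v = gv v ^ m, gv w ^ (h * k^-1) = gv w ^ m & v = w \/ adj v w].
  exists (m * k); split=> //; first by rewrite conjgM -e1.
  by rewrite conjgM -e2 -conjgM mulgVK.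
have {c} : commute (gv v ^ (k * h^-1)) (gv w).
  by rewrite conjgM -commute_conjVr.
rewrite -[k * h^-1]invgK invgM invgK; move: (h * k^-1) => {h k}h /commute_gv sh.
pose a : letter G := (v, false); pose t := gv v ^ h^-1.
have [[n sn] [n' sn']] := start_lgen_pow a h^-1.
have tX i : gv v ^+ i * h^-1 = h^-1 * t ^+ i.
  by rewrite conjgC conjXg.
have tV i : gv v ^- i * h^-1 = h^-1 * t ^- i.
  by rewrite conjgC conjVg conjXg.
have [//||w1 [w2 [wE sm]]] := @cross_up _ a (lgen a ^- n' * h^-1) (nf (t ^+ (n' + n))).
  by rewrite nfK -[lgen a]/(gv v) tV expgnDr -mulgA mulKg -tX.
have /allP sw : suppw (st w) (nf (t ^+ (n' + n))) by apply: subX.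
have vw : st w v by apply: (sw a); rewrite wE mem_cat mem_head orbT.
pose s := t ^- n' * cls w1.
have ss : sub (st w) s.
  apply: subM; first by apply/subV/subX.
  by apply: sub_word; apply/allP=> x xw; apply: sw; rewrite wE mem_cat xw.
exists (s^-1 * h); split.
- rewrite commute_conj_id //; apply/commute_gv; rewrite -[s^-1 * h]invgK; apply: subV.
  rewrite invgM invgK /s mulgA -tV; apply: subS sm => x vx; by rewrite /st vx orbT.
- by rewrite conjgM [gv w ^ s^-1]commute_conj_id //; apply/commute_gv/subV.
- by case/orP: vw => [/eqP->|]; [left | rewrite adj_sym; right].
Qed.

(* The vertices of the extension graph; its edges are the commuting pairs. *)
Definition isE g := exists v k, g = gv v ^ k.

Lemma isE_gv v : isE (gv v).
Proof. by exists v, 1; rewrite conjg1. Qed.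

Lemma isEJ X k : isE X -> isE (X ^ k).
Proof. by case=> v [h ->]; exists v, (h * k); rewrite conjgM. Qed.

Lemma commute_isEX X n z : isE X -> 0 < n -> commute z (X ^+ n) -> commute z X.
Proof.
case=> v [k ->] n0; rewrite -conjXg !commute_conjVr => /(commute_gvX n0).
by move/commute_gv.
Qed.

Lemma adj_neqv x y : adj x y -> x != y.
Proof. by move=> xy; apply/eqP=> e; rewrite e adj_irr in xy. Qed.

Hypothesis girth : no_short_cycles G.

Lemma no_triangle x y (z : vert G) : adj x y -> adj y z -> adj x z = false.
Proof.
move=> xy yz; apply/negP=> xz.
have C : cycle (@adj G) [:: x; y; z] by rewrite /= xy yz adj_sym xz.
have U : uniq [:: x; y; z].
  by rewrite /= !inE !negb_or !andbT (adj_neqv xy) (adj_neqv xz) (adj_neqv yz).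
by have := girth U C isT.
Qed.

Lemma common_nbr_uniq x (z : vert G) y y' : x != z -> adj x y -> adj z y ->
  adj x y' -> adj z y' -> y = y'.
Proof.
move=> xz xy zy xy' zy'; apply/eqP/negPn/negP=> yy'.
have yz : adj y z by rewrite adj_sym.
have C : cycle (@adj G) [:: x; y; z; y'] by rewrite /= xy yz zy' adj_sym xy'.
have U : uniq [:: x; y; z; y'].
  by rewrite /= !inE !negb_or !andbT xz yy' !adj_neqv.
by have := girth U C isT.
Qed.

Lemma st2_commute v w : v != w -> forall x y,
  predI (st v) (st w) x -> predI (st v) (st w) y -> x = y \/ adj x y.
Proof.
move=> vw x y /andP[vx wx] /andP[vy wy].
case: (eqVneq x v) vx => [->|xv] vx.
  by case/orP: vy => [/eqP->|]; [left|right].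
case: (eqVneq y v) vy => [->|yv] vy.
  by case/orP: vx => [/eqP->|]; [left|rewrite adj_sym; right].
case: (eqVneq x w) wx => [->|xw] wx.
  by case/orP: wy => [/eqP->|]; [left|right].
case: (eqVneq y w) wy => [->|yw] wy.
  by case/orP: wx => [/eqP->|]; [left|rewrite adj_sym; right].
move: vx vy wx wy; rewrite /st !(negbTE xv, negbTE yv, negbTE xw, negbTE yw) /= => *.
by left; apply: (@common_nbr_uniq v w).
Qed.

(** The support of [W] lies in two stars, whose intersection is a clique. This clique contains the
    generator [w] that [W] is conjugate to, so [W] commutes with [gv w] and shares a translate with
    it. *)
Lemma isE_common_gv W v v' : v != v' -> isE W -> commute W (gv v) -> commute W (gv v') ->
  exists u, W = gv u.
Proof.
move=> vv' [w [k eW]] /commute_gv s /commute_gv s'.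
have sW := subI s s'; have pw : predI (st v) (st v') w.
  by apply: par_sub sW; rewrite eW parJ par_gv.
have : commute (gv w ^ k) (gv w ^ 1).
  rewrite -eW conjg1; apply: sub_commute (st2_commute vv') sW _; by rewrite sub_lgen.
by case/commute_common_conj=> m [e1 e2 _]; exists w; rewrite eW e1 -e2 conjg1.
Qed.

(** Translates containing [X] and [Y] are chosen as close as possible. If they coincide, both
    elements live on a clique, the intersection of two stars. Otherwise they live on the part of
    [st v] adjacent to the first letter [c] of the gap [m], which has at most one vertex. *)
Lemma commute_isE2 X Y p q : isE X -> isE Y -> X <> Y ->
  commute p X -> commute p Y -> commute q X -> commute q Y -> commute p q.
Proof.
case=> v [k0 eX] [w [h0 eY]] XY pX pY qX qY.
pose P (kh : raag G * raag G) := X = gv v ^ kh.1 /\ Y = gv w ^ kh.2.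
have [|[k h] [/= {}eX {}eY] mmin] := @ex_min_measure _ P (fun kh => len (kh.1 * kh.2^-1)).
  by exists (k0, h0).
have cent z : commute z X -> commute z Y -> sub (st v) (z ^ k^-1) /\ sub (st w) (z ^ h^-1).
  by rewrite eX eY !commute_conjVr !commute_gv.
have [{pX pY}pv pw] := cent p pX pY; have [{qX qY cent}qv qw] := cent q qX qY.
apply/(commuteJ _ _ k^-1).
case: (EM (k = h)) => [kh|kh].
  have vw : v != w by apply/eqP=> vw; apply: XY; rewrite eX eY kh vw.
  rewrite -kh in pw qw.
  by apply: (sub_commute (st2_commute vw)); apply: subI.
pose m := k * h^-1; have ml s : sub (st v) s -> len m <= len (s * m).
  move=> ss; have := mmin (s * k, h); rewrite /= /m mulgA; apply; split=> //=.
  by rewrite conjgM [gv v ^ s]commute_conj_id //; apply/commute_gv.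
have mr s : sub (st w) s -> len m <= len (m * s).
  move=> ss; have := mmin (k, s^-1 * h); rewrite /= /m invgM invgK mulgA; apply; split=> //=.
  by rewrite conjgM [gv w ^ s^-1]commute_conj_id //; apply/commute_gv/subV.
have [c sc] : exists c, start c m.
  by apply: len_gt0 => m1; apply: kh; apply: divg1_eq.
have cv : ~~ st v c.1.
  apply/negP=> vc; have := ml (lgen (linv c)); rewrite sub_lgen => /(_ vc).
  by rewrite (start_len sc) lgen_linv ltnn.
(* In [z * m = m * z ^ m] both sides are reduced products, so [z * m] starts with [c] because [m]
   does. As [c] is outside [st v], this letter comes from [m] and commutes with all of [z]. *)
have key z : sub (st v) (z ^ k^-1) -> sub (st w) (z ^ h^-1) ->
    sub (predI (st v) (adj c.1)) (z ^ k^-1).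
  move=> zv zw; apply: subI => //; move: zv; rewrite -(mulKg k h^-1) -/m conjgM in zw.
  move: (z ^ k^-1) zw => {}z zw zv.
  have s1 : start c (z * m).
    have rd := minr_reduced mr zw.
    have -> : z * m = cls (nf m ++ nf (z ^ m)) by rewrite cls_cat !nfK -conjgC.
    rewrite start_cls // pull_cat; by move: sc; rewrite /start; case: (pull c _).
  have s0 : ~~ start c z by apply: contra cv => /start_sub; apply.
  have := s1; rewrite -{1}[m]nfK => /(cross_up s0)[w1 [w2 [mE sz]]].
  have := minl_reduced ml zv; rewrite mE catA => /reduced_cat[rd _].
  by move: sz; rewrite -{1}[z]nfK -cls_cat sub_cls // /suppw all_cat => /andP[].
apply: sub_commute (key p pv pw) (key q qv qw) => x y /andP[vx cx] /andP[vy cy].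
have vc : v != c.1 by apply: contra cv => /eqP->; rewrite /st eqxx.
have nv u : st v u -> adj c.1 u -> adj v u.
  by case/orP=> // /eqP-> cu; move: cv; rewrite /st adj_sym cu orbT.
by left; apply: (common_nbr_uniq vc); rewrite ?nv.
Qed.

(** Two different solutions would commute by [commute_isE2] and form a triangle with [X] inside one
    translate. *)
Lemma isE_common_uniq X Y W1 W2 : isE X -> isE Y -> isE W1 -> isE W2 -> X <> Y ->
  commute W1 X -> commute W1 Y -> commute W2 X -> commute W2 Y ->
  W1 <> X -> W2 <> X -> W1 = W2.
Proof.
move=> EX EY E1 E2 XY c1X c1Y c2X c2Y n1 n2; apply: contrapT => n12.
have c12 := commute_isE2 EX EY XY c1X c1Y c2X c2Y.
have [w1 [k1 e1]] := E1; have [w2 [k2 e2]] := E2; rewrite e1 e2 in c12.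
have [m [{}e1' {}e2' w12]] := commute_common_conj c12.
rewrite e1' in e1; rewrite e2' in e2.
have {}w12 : adj w1 w2 by case: w12 => // e; case: n12; rewrite e1 e2 e.
have ww : w1 != w2 by apply/eqP=> e; rewrite e adj_irr in w12.
rewrite e1 in c1X n1; rewrite e2 in c2X n2.
move/commute_sym/commute_conjVr in c1X; move/commute_sym/commute_conjVr in c2X.
have [x ex] := isE_common_gv ww (isEJ m^-1 EX) c1X c2X.
have eX : X = gv x ^ m by rewrite -ex conjgKV.
rewrite ex in c1X c2X.
have {}c1X : adj x w1 by case/commute_gv2: c1X => // e; case: n1; rewrite eX e.
have {}c2X : adj x w2 by case/commute_gv2: c2X => // e; case: n2; rewrite eX e.
by move: c2X; rewrite (no_triangle c1X w12).
Qed.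

Lemma isE_pow_inj X Y n m : isE X -> isE Y -> 0 < n -> 0 < m ->
  X ^+ n = Y ^+ m \/ X ^+ n = Y ^- m -> X = Y.
Proof.
move=> EX EY n0 m0 e; have c : commute (X ^+ n) Y.
  by case: e => ->; [|apply: commute_Vl]; apply/commute_Xl/commute_refl.
have [v [k eX]] := EX; have [w [h eY]] := EY.
move/commute_sym/(commute_isEX EX n0)/commute_sym: c; rewrite eX eY => /commute_common_conj.
case=> l [eX' eY' _]; rewrite eX' eY'; congr (gv _ ^ _).
have sw i : sub (pred1 w) (gv w ^+ i) by apply: subX; rewrite sub_lgen /=.
have : sub (pred1 w) (gv v ^+ n).
  case: e; rewrite eX eY eX' eY' -!conjXg -?conjVg => /conjg_inj -> //; exact: subV.
by rewrite -cls_nseq sub_cls ?nseq_reduced // /suppw all_nseq; case: n n0 {e} => //= n _ /eqP.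
Qed.

End CommutingConjugates.

(** * Elements with non-abelian centralizer *)

Section PowersOfVertices.
Variable G : sgraph.
Implicit Types (a c : letter G) (g k p q z X Y : raag G).

(** A letter cancelling across the seam of [g * g] would shorten [g] by conjugation. *)
Lemma conj_min_reduced g : (forall k, len g <= len (g ^ k)) -> reduced (nf g ++ nf g).
Proof.
move=> gmin; apply: contraT.
case/(not_reduced_cat (nf_reduced g) (nf_reduced g))=> c [u [v [gE cv]]].
rewrite gE pull_cat; case E: (pull _ u) => [u'|]; last first.
  by case: ifP => // _; rewrite /= adj_irr eq_sym (negbTE (linv_neq c)).
move=> _; have := gmin (lgen c)^-1; have -> : g ^ (lgen c)^-1 = cls (u' ++ v).
  rewrite -{1}[g]nfK gE cls_cat (shuffle_cls (adjall_shuffle cv)) !cls_cat.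
  by rewrite (pull_cls E) lgen_linv conjgE invgK -/(lgen c) !mulgA mulgK mulgV mul1g.
move=> /leq_trans /(_ (len_le _)); rewrite {1}/len gE !size_cat /=.
by rewrite (perm_size (pull_perm E)) /= addSn addnS -addSn ltnNge leq_add2r leqnSn.
Qed.

(** Stands in for generating a free group of rank 2. *)
Definition indep p q := forall i j, 0 < i -> 0 < j -> ~ commute (p ^+ i) (q ^+ j).

Lemma indepJ p q k : indep p q -> indep (p ^ k) (q ^ k).
Proof. by move=> pq i j i0 j0; rewrite -!conjXg commuteJ; apply: pq. Qed.

Definition pow_of X g := exists n, 0 < n /\ (g = X ^+ n \/ g = X ^- n).

Lemma pow_ofJ X g k : pow_of X g -> pow_of (X ^ k) (g ^ k).
Proof.
by case=> n [n0 e]; exists n; split=> //; case: e => ->; rewrite ?conjVg conjXg; [left|right].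
Qed.

Lemma commute_pow_of X g z : isE X -> pow_of X g -> (commute z g <-> commute z X).
Proof.
move=> EX [n [n0 e]]; split=> c; last by case: e => ->; [|apply: commuteV]; apply: commuteX.
apply: (commute_isEX EX n0); case: e c => -> // /commuteV; by rewrite invgK.
Qed.

Lemma pow_of_lgen (a : letter G) : pow_of (gv a.1) (lgen a).
Proof. by exists 1%N; split=> //; case: a => v [] /=; rewrite lgenE expg1; [right|left]. Qed.

Lemma pow_ofM X g h : pow_of X g -> pow_of X h -> g * h <> 1 -> pow_of X (g * h).
Proof.
have key m n : X ^+ m * X ^- n <> 1 -> pow_of X (X ^+ m * X ^- n).
  move=> n1; case: (ltngtP m n) => [lt|lt|e]; last by case: n1; rewrite e mulgV.
    exists (n - m)%N; rewrite subn_gt0; split=> //; right.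
    by rewrite expgnFr ?invgM ?invgK //; apply: ltnW.
  exists (m - n)%N; rewrite subn_gt0; split=> //; left.
  by rewrite expgnFr //; apply: ltnW.
have c m n : X ^- m * X ^+ n = X ^+ n * X ^- m.
  by apply/commute_Vl/commuteX2/commute_refl.
case=> m [m0 [->|->]] [n [n0 [->|->]]]; rewrite ?c; try exact: key; move=> _.
  by exists (m + n)%N; rewrite addn_gt0 m0; split=> //; left; rewrite expgnDr.
by exists (n + m)%N; rewrite addn_gt0 n0; split=> //; right; rewrite expgnDr invgM.
Qed.

Hypothesis girth : no_short_cycles G.

(* Induction on the length of [g].  If [g = a g'] is cyclically reduced then, after replacing [p]
   and [q] by products of powers of them with powers of [g], both fix the wall dual to [a], hence
   commute with [a] and with [g']; as centralizers of distinct vertices meet in an abelian group,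
   [g'] is a power of [a]. *)
Lemma indep_centralizer g p q : g <> 1 -> commute p g -> commute q g -> indep p q ->
  exists2 X, isE X & pow_of X g.
Proof.
have [n] := ubnP (len g); elim: n g p q => // n IH g p q lt_gn g1 pg qg pq.
case: (EM (exists k, len (g ^ k) < len g)) => [[k lt_k]|gmin].
  have [|||||X EX Xg] := IH (g ^ k) (p ^ k) (q ^ k).
  - exact: leq_trans lt_k _.
  - by move/eqP; rewrite conjg_eq1 => /eqP.
  - exact/commuteJ.
  - exact/commuteJ.
  - exact: indepJ.
  by exists (X ^ k^-1); [apply: isEJ | rewrite -[g](conjgK k); apply: pow_ofJ].
have rww : reduced (nf g ++ nf g).
  by apply: conj_min_reduced => k; rewrite leqNgt; apply/negP=> lt; apply: gmin; exists k.
case E: (nf g) rww => [|a w] rww; first by case: g1; rewrite -[g]nfK E.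
have gE : g = cls (a :: w) by rewrite -[LHS]nfK E.
have lt_w : len (cls w) < n.
  by rewrite (leq_trans _ (_ : len g <= n)) // /len E ltnS; apply: len_le.
have [|i [z [i0 cz sp]]] := @power_fix_wall _ a w p rww; first by rewrite -gE.
have [|j [y [j0 cy sq]]] := @power_fix_wall _ a w q rww; first by rewrite -gE.
rewrite -gE in cz cy; set p1 := (p ^+ i * z) in sp; set q1 := (q ^+ j * y) in sq.
have zg : commute z g by apply/commute_sym/cz/commute_refl.
have yg : commute y g by apply/commute_sym/cy/commute_refl.
have p1g : commute p1 g by apply: commute_Ml => //; apply: commute_Xl.
have q1g : commute q1 g by apply: commute_Ml => //; apply: commute_Xl.
(* The corrections [z] and [y] commute with [p], [q] and each other, so commuting powers of [p1] and
   [q1] give commuting powers of [p] and [q]. *)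
have pq1 : indep p1 q1.
  move=> k l k0 l0 c; apply: (pq (i * k)%N (j * l)%N); rewrite ?muln_gt0 ?i0 ?j0 //.
  have pz : commute (p ^+ i) z by apply/commute_Xl/cz.
  have qy : commute (q ^+ j) y by apply/commute_Xl/cy.
  rewrite !expgnA; have -> : p ^+ i ^+ k = p1 ^+ k * z ^- k by rewrite expgMn // mulgK.
  have -> : q ^+ j ^+ l = q1 ^+ l * y ^- l by rewrite expgMn // mulgK.
  apply: commute_Ml; apply: commuteM => //.
  - by apply/commuteV/commuteX/cy/commute_Xl.
  - by apply/commute_Vl/commuteX2/commute_sym/cz.
  - by apply/commute_Vl/commuteV/commuteX2/cy.
have st_sub t : sub (adj a.1) t -> commute t (gv a.1).
  by move=> s; apply: sub_st_commute; apply: subS s => x ax; rewrite /st ax orbT.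
have g'E : cls w = (lgen a)^-1 * g by rewrite gE cls_cons mulKg.
have ca t : commute t (gv a.1) <-> commute t (lgen a).
  by symmetry; apply: commute_pow_of; [apply: isE_gv | apply: pow_of_lgen].
case: (EM (cls w = 1)) => [w1|w1].
  exists (gv a.1); first exact: isE_gv.
  by rewrite gE cls_cons w1 mulg1; apply: pow_of_lgen.
have cg' t : commute t g -> commute t (gv a.1) -> commute t (cls w).
  by rewrite ca g'E => tg ta; apply: commuteM => //; apply: commuteV.
have [Y EY Yg] := IH (cls w) p1 q1 lt_w w1 (cg' _ p1g (st_sub _ sp)) (cg' _ q1g (st_sub _ sq)) pq1.
have cY t : commute t g -> commute t (gv a.1) -> commute t Y.
  by move=> tg ta; apply/(commute_pow_of _ EY Yg); apply: cg'.
have eY : gv a.1 = Y.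
  apply: contrapT => nY; apply: (pq1 1%N 1%N) => //; rewrite !expg1.
  by apply: (commute_isE2 girth (isE_gv a.1) EY nY); auto.
exists Y => //; rewrite gE cls_cons; apply: pow_ofM => //; last by rewrite -cls_cons -gE.
by rewrite -eY; apply: pow_of_lgen.
Qed.
End PowersOfVertices.

(** * From group embeddings to maps of extension graphs *)

Section Homomorphisms.
Variables (D H : sgraph) (f : vert D -> word H).

Lemma wsubst_cat u v : wsubst f (u ++ v) = wsubst f u ++ wsubst f v.
Proof. by rewrite /wsubst map_cat flatten_cat. Qed.

Lemma wsubst_cls_eq w1 w2 : is_raag_hom f -> raag_eq w1 w2 ->
  cls (wsubst f w1) = cls (wsubst f w2).
Proof.
move=> hom; elim=> {w1 w2} //.
- by move=> w1 w2 w3 _ -> _ ->.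
- move=> u v [x e]; rewrite !wsubst_cat !cls_cat; congr (_ * _).
  rewrite cls_nil mulg1; case: e => /=; rewrite cls_winv.
    by rewrite mulVg mul1g.
  by rewrite mulgV mul1g.
- move=> u v x y /hom/clsP e; rewrite !wsubst_cat cls_cat.
  by rewrite [cls (wsubst f (commw x y) ++ _)]cls_cat e cls_nil mul1g -cls_cat.
Qed.
End Homomorphisms.

Lemma raag_embeds_morphism D H : raag_embeds D H ->
  exists F : raag D -> raag H, {morph F : x y / x * y} /\ injective F.
Proof.
case=> f [hom ker]; pose F (g : raag D) := cls (wsubst f (repr g)).
have Fcls w : F (cls w) = cls (wsubst f w).
  by apply: wsubst_cls_eq => //; apply: raag_eq_repr.
have FM : {morph F : x y / x * y}.
  by move=> x y; rewrite -[x]nfK -[y]nfK -cls_cat !Fcls wsubst_cat cls_cat.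
have F1 : F 1 = 1 by rewrite -cls_nil Fcls.
have Fk x : F x = 1 -> x = 1.
  by rewrite -[x]nfK Fcls => /clsP/ker e; apply/clsP.
exists F; split=> // x y e; apply: divg1_eq; apply: Fk.
by rewrite FM e -FM mulgV.
Qed.

(* Maps between extension graphs; [emapJ] does not ask [th] to be a homomorphism. *)
Record emap D H (phi : raag D -> raag H) : Prop := Emap {
  emapE : forall X, isE X -> isE (phi X);
  emapC : forall X Y, isE X -> isE Y -> (commute (phi X) (phi Y) <-> commute X Y);
  emap_inj : forall X Y, isE X -> isE Y -> phi X = phi Y -> X = Y;
  emapJ : exists th : raag D -> raag H, forall X g, isE X -> phi (X ^ g) = phi X ^ th g }.

Lemma emap_id D : emap (@id (raag D)).
Proof. by split=> //; exists id. Qed.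

Lemma emap_comp D H K (phi : raag D -> raag H) (psi : raag H -> raag K) :
  emap phi -> emap psi -> emap (psi \o phi).
Proof.
move=> [E1 C1 I1 [t1 J1]] [E2 C2 I2 [t2 J2]]; split=> /=.
- by move=> X /E1/E2.
- by move=> X Y EX EY; rewrite C2 ?C1 //; apply: E1.
- by move=> X Y EX EY /I2 e; apply: I1 => //; apply: e; apply: E1.
- by exists (t2 \o t1) => X g EX; rewrite /= J1 // J2 //; apply: E1.
Qed.

Definition has_free_links D :=
  forall v : vert D, exists a b : vert D, [/\ adj v a, adj v b, a != b & ~~ adj a b].

(** Two non-adjacent neighbours of a generator have independent images centralizing its image. So
    the image of a vertex is a power of a vertex, and of only one by uniqueness of roots; that one
    is [phi X]. *)
Lemma emap_of_morphism D H (F : raag D -> raag H) : no_short_cycles H -> has_free_links D ->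
  {morph F : x y / x * y} -> injective F -> exists phi : raag D -> raag H, emap phi.
Proof.
move=> girth links FM Finj.
have F1 : F 1 = 1 by apply: (mulgI (F 1)); rewrite -FM !mulg1.
have FV x : F x^-1 = (F x)^-1 by apply: (mulgI (F x)); rewrite -FM !mulgV.
have FX n x : F (x ^+ n) = F x ^+ n.
  by elim: n => [|n IH]; rewrite ?expg0 // !expgS FM IH.
have FJ x y : F (x ^ y) = F x ^ F y by rewrite !conjgE !FM FV.
have Fc x y : commute (F x) (F y) <-> commute x y.
  by rewrite /commute -!FM; split=> [/Finj|->].
have [phi phiP] : exists phi, forall X, isE X -> isE (phi X) /\ pow_of (phi X) (F X).
  suff /choice[phi phiP] : forall X, exists X', isE X -> isE X' /\ pow_of X' (F X).
    by exists phi.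
  (* The value 1 off the vertices is arbitrary. *)
  move=> X; case: (EM (isE X)) => [[v [k ->]]|nE]; last by exists 1.
  have [a [b [va vb ab nab]]] := links v.
  have [||||X' EX pX] := @indep_centralizer _ girth (F (gv v)) (F (gv a)) (F (gv b)).
  - by rewrite -F1 => /Finj/(congr1 (par v)); rewrite par_gv eqxx -cls_nil par_cls.
  - by apply/Fc; apply: gv_comm; rewrite adj_sym.
  - by apply/Fc; apply: gv_comm; rewrite adj_sym.
  - move=> i j i0 j0; rewrite -!FX Fc => c.
    have := commute_isEX (isE_gv b) j0 c => /commute_sym/(commute_isEX (isE_gv a) i0).
    by case/commute_gv2=> [e|]; [rewrite e eqxx in ab|rewrite adj_sym (negbTE nab)].
  exists (X' ^ F k) => _; rewrite FJ; split; [exact: isEJ | exact: pow_ofJ].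
have uniqP (X X' Y : raag H) : isE X -> isE X' -> pow_of X Y -> pow_of X' Y -> X = X'.
  move=> EX EX' [n [n0 e]] [m [m0 e']]; apply: (isE_pow_inj EX EX' n0 m0).
  case: e e' => -> [] e; [by left|by right| |].
    by right; rewrite -e invgK.
  by left; apply: invg_inj.
exists phi; split.
- by move=> X /phiP[].
- move=> X Y EX EY; have [EX' pX] := phiP _ EX; have [EY' pY] := phiP _ EY.
  rewrite -Fc (commute_pow_of _ EY' pY); split=> /commute_sym c; apply/commute_sym.
    exact/(commute_pow_of _ EX' pX).
  exact/(commute_pow_of _ EX' pX).
- move=> X Y EX EY e; have [EX' pX] := phiP _ EX; have [_ pY] := phiP _ EY.
  rewrite -e in pY; move: pX pY => [n [n0 eX]] [m [m0 eY]].
  apply: (isE_pow_inj EX EY m0 n0).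
  have [eXY|eXY] : F X ^+ m = F Y ^+ n \/ F X ^+ m = F Y ^- n.
  + have c := expgnAC (phi X) n m.
    by case: eX eY => -> [] ->; rewrite ?expVgn ?invgK c; [left|right|right|left].
  + by left; apply: Finj; rewrite !FX.
  + by right; apply: Finj; rewrite FV !FX.
- exists F => X g EX; have [EX' pX] := phiP _ EX.
  have [E1 p1] := phiP _ (isEJ g EX).
  by apply: (uniqP _ _ (F (X ^ g)) E1 (isEJ (F g) EX') p1); rewrite FJ; apply: pow_ofJ.
Qed.

(** * Walls separating vertices of the extension graph *)

Section Walls.
Variable G : sgraph.
Implicit Types (a c : letter G) (u v : vert G) (g h k t W X Y : raag G).

(* [X] is a vertex of the translate of the defining graph by [h]. *)
Definition onT h X := exists v, X = gv v ^ h.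
(* The wall dual to the edge [(h^-1, h^-1 a)], evaluated at the point [k^-1] of the Cayley graph. *)
Definition side h a k : bool := start a (h * k^-1).
Definition onside h a s X := forall k, onT k X -> side h a k = s.

Lemma gv_conj_eq v k k' : gv v ^ k = gv v ^ k' <-> sub (st v) (k * k'^-1).
Proof.
rewrite -commute_gv; split=> [e|c]; last first.
  by rewrite -[k](mulgVK k') conjgM (commute_conj_id c).
by apply: commute_sym; rewrite /commute conjgC conjgM e conjgK.
Qed.

(** Translates containing [X] correspond to a coset of the subgroup on [st v]. A path inside it
    between the two sides crosses the wall by the letter [a], which lies in [st v]; at the crossing,
    [X] and the vertex of the wall share a translate. *)
Lemma side_commute h a k k' X : onT k X -> onT k' X -> ~~ side h a k -> side h a k' ->
  commute X (gv a.1 ^ h).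
Proof.
case=> v eX [v' eX'] nk sk'.
have evv' : v = v' by apply: (@gv_conj_inj _ v v' k k'); rewrite -eX -eX'.
have sv : sub (st v) (k * k'^-1) by apply/gv_conj_eq; rewrite -eX eX' evv'.
have := sk'; rewrite /side -[k'^-1](mulKg k) mulgA -[X in _ * X]nfK.
case/(cross_up nk)=> w1 [w2 [wE sm]].
have /allP sw := sv; have va : st v a.1 by apply: (sw a); rewrite wE mem_cat mem_head orbT.
have sw1 : sub (st v) (cls w1).
  by apply: sub_word; apply/allP=> x xw; apply: sw; rewrite wE mem_cat xw.
have -> : X = gv v ^ ((cls w1)^-1 * k).
  by rewrite eX; apply/gv_conj_eq; rewrite invgM invgK mulgA mulgV mul1g.
have -> : gv a.1 ^ h = gv a.1 ^ ((cls w1)^-1 * k).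
  apply/gv_conj_eq; rewrite invgM invgK mulgA.
  by apply: subS sm => x ax; rewrite /st ax orbT.
by apply/commuteJ/commute_gv; rewrite sub_lgen st_sym.
Qed.

Lemma onside_side h a k X : onT k X -> ~ commute X (gv a.1 ^ h) -> onside h a (side h a k) X.
Proof.
move=> kX nc k' k'X; apply/idP/idP => s; apply: contraT => ns; case: nc.
  exact: (side_commute kX k'X).
exact: (side_commute k'X kX).
Qed.

(** A commuting [X] shares a translate [m] with the vertex of the wall; multiplying [m] by powers of
    [a] keeps [X] and reaches both sides. *)
Lemma onside_not_commute h a s X : isE X -> onside h a s X -> ~ commute X (gv a.1 ^ h).
Proof.
case=> v [k ->] hX /commute_common_conj[m [eX ea va]]; rewrite eX in hX.
have cm : sub (st a.1) (h * m^-1) by apply/gv_conj_eq.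
have /commute_sym c : commute (h * m^-1) (lgen a).
  by apply/(commute_pow_of _ (isE_gv a.1) (pow_of_lgen a))/commute_gv.
have cv : commute (gv v) (lgen a).
  by apply/(commute_pow_of _ (isE_gv a.1) (pow_of_lgen a))/commute_gv2.
have on t : commute (gv v) t -> onT (t * m) (gv v ^ m).
  by move=> ct; exists v; rewrite conjgM [gv v ^ t]commute_conj_id //; apply: commute_sym.
have [[n sn] [n' sn']] := start_lgen_pow a (h * m^-1).
have e1 : side h a (lgen a ^- n * m) = s by apply/hX/on/commuteV/commuteX.
have e2 : side h a (lgen a ^+ n' * m) = s by apply/hX/on/commuteX.
move: e1 e2; rewrite /side !invgM invgK !mulgA.
have <- : lgen a ^+ n * (h * m^-1) = h * m^-1 * lgen a ^+ n by apply: commute_Xl.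
have <- : lgen a ^- n' * (h * m^-1) = h * m^-1 * lgen a ^- n'.
  by apply: commute_Vl; apply: commute_Xl.
by rewrite sn (negbTE sn') => <-.
Qed.

Lemma isE_onT X : isE X -> exists k, onT k X.
Proof. by case=> v [k ->]; exists k, v. Qed.

Lemma onside_absurd h a X : isE X -> onside h a true X -> onside h a false X -> False.
Proof. by case/isE_onT=> k kX h1 h2; have := h1 k kX; rewrite (h2 k kX). Qed.

Lemma onside_commute h a s X Y : isE X -> isE Y -> commute X Y ->
  ~ commute Y (gv a.1 ^ h) -> onside h a s X -> onside h a s Y.
Proof.
case=> v [k ->] [w [l ->]] /commute_common_conj[m [-> -> _]] nc hX.
by rewrite -(hX m); [apply: onside_side => //; exists w | exists v].
Qed.

(* Walk from [h] towards the coset of points carrying [s]: each step either keeps all vertices of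
   [T] seen so far or crosses a wall separating one of them from [s]. *)
Lemma walk (T : raag G -> Prop) h s : isE s ->
  (exists h', onT h' s /\ forall t, T t -> onT h t -> onT h' t) \/
  (exists h' a t, [/\ T t, forall t', T t' -> onT h t' -> onT h' t',
                     onside h' a true s & onside h' a false t]).
Proof.
move=> Es; have [k0 k0s] := isE_onT Es.
have [n] := ubnP (len (h * k0^-1)); elim: n h k0 k0s => // n IH h k0 k0s lt_n.
have [|k ks kmin] := @ex_min_measure _ (fun k => onT k s) (fun k => len (h * k^-1)).
  by exists k0.
case: (EM (h * k^-1 = 1)) => [/divg1_eq hk|nhk]; first by left; exists h; rewrite hk.
have [c sc] := len_gt0 nhk.
(* As [k] is nearest to [h], products of [h * k^-1] with the subgroup on [st v] are reduced and keep
   the first letter [c]. So every translate containing [s] lies beyond the wall. *)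
have hs : onside h c true s.
  move=> k' k's; have [v eX] := ks; have [v' eX'] := k's.
  have evv' : v = v' by apply: (@gv_conj_inj _ v v' k k'); rewrite -eX -eX'.
  have sv : sub (st v) (k * k'^-1) by apply/gv_conj_eq; rewrite -eX eX' evv'.
  have mr t : sub (st v) t -> len (h * k^-1) <= len (h * k^-1 * t).
    move=> vt; have := kmin (t^-1 * k); rewrite invgM invgK mulgA; apply; exists v.
    rewrite eX conjgM [gv v ^ t^-1]commute_conj_id //; apply: sub_st_commute.
    exact: subV.
  have rd := minr_reduced mr sv.
  rewrite /side -[k'^-1](mulKg k) mulgA -[X in X * _]nfK -[X in _ * X]nfK -cls_cat.
  by rewrite start_cls // pull_cat; move: sc; rewrite /start; case: (pull c _).
case: (EM (exists t, [/\ T t, onT h t & ~ onT ((lgen c)^-1 * h) t])) => [[t [Tt ht nt]]|no].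
  right; exists h, c, t; split=> //.
  have -> : false = side h c h by rewrite /side mulgV start1.
  apply: onside_side => //; case: ht nt => u -> nt /commuteJ cu; apply: nt; exists u.
  rewrite conjgM [gv u ^ (lgen c)^-1]commute_conj_id //; apply: commute_Vl; apply: commute_sym.
  by apply/(commute_pow_of _ (isE_gv c.1) (pow_of_lgen c)).
have step t : T t -> onT h t -> onT ((lgen c)^-1 * h) t.
  by move=> Tt ht; apply: contrapT => nt; apply: no; exists t.
have [|[h' [h's h'T]]|[h' [a [t [Tt h'T st tt]]]]] := IH ((lgen c)^-1 * h) k ks.
- rewrite -mulgA -ltnS -(start_len sc).
  by apply: leq_ltn_trans (kmin _ k0s) _.
- by left; exists h'; split=> // t Tt /(step _ Tt); apply: h'T.
- by right; exists h', a, t; split=> // t' Tt' /(step _ Tt'); apply: h'T.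
Qed.

(** A Helly-type dichotomy: from a translate containing the most [X i], walking towards a missing
    one either gains it or meets a separating wall. *)
Lemma common_point_or_wall (I : finType) (X : I -> raag G) (U : pred I) :
  (forall i, isE (X i)) -> (exists h, forall i, U i -> onT h (X i)) \/
  exists h a i j, [/\ U i, U j, onside h a true (X i) & onside h a false (X j)].
Proof.
move=> EX; pose N h := [set i | U i && `[< onT h (X i) >]].
have [||h _ hmax] := @ex_max_measure _ (fun=> True) (fun h => #|N h|) #|I|.
- by move=> h; apply: max_card.
- by exists 1.
case: (EM (exists2 i, U i & ~ onT h (X i))) => [[i Ui ni]|no]; last first.
  by left; exists h => i Ui; apply: contrapT => ni; apply: no; exists i.
right; have [[h' [h'i h'T]]|[h' [a [t [[j Uj ->] _ si sj]]]]] :=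
    @walk (fun t => exists2 j, U j & t = X j) h (X i) (EX i); last first.
  by exists h', a, i, j.
suff /proper_card : N h \proper N h' by rewrite ltnNge hmax.
apply/properP; split; last by exists i; rewrite !inE Ui; [apply/asboolP|apply/negP=> /asboolP].
apply/subsetP=> j; rewrite !inE => /andP[Uj /asboolP hj]; rewrite Uj.
by apply/asboolP/h'T => //; exists j.
Qed.

End Walls.

(** * Connectivity of atomic graphs *)

Section GraphFacts.
Variable D : sgraph.
Implicit Types (x y v : vert D) (Z : {set vert D}).

Definition avoid Z : rel (vert D) := [rel a b | [&& adj a b, a \notin Z & b \notin Z]].

(** To be applied to the set of vertices whose images commute with the vertex of a wall: a closed
    star when that vertex is itself an image. *)
Definition well_connected := forall Z x y, x \notin Z -> y \notin Z ->
  #|Z| <= 1 \/ (exists v, Z = closed_star v) -> connect (avoid Z) x y.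

Lemma card_nbhd_gt1 x y : no_valence_one D -> adj x y -> 1 < #|nbhd x|.
Proof.
move=> nv xy; have := nv x; case: #|_| (cardD1 y (nbhd x)) => [|[|n]] //.
by rewrite inE xy.
Qed.

Lemma atomic_well_connected : atomic D -> well_connected.
Proof.
move=> [[_ conn] nv girth nsep] Z x y xZ yZ.
have star v x' y' : x' \notin closed_star v -> y' \notin closed_star v ->
    connect (avoid (closed_star v)) x' y'.
  by move=> hx hy; apply: contraT => nc; case: (nsep v); exists x', y'.
case=> [|[v ZE]]; last by move: xZ yZ; rewrite ZE; apply: star.
rewrite leq_eqVlt ltnS leqn0 => /orP[/cards1P[v ZE]|]; last first.
  rewrite cards_eq0 => /eqP ZE; move: (conn x y); apply: connect_sub => a b ab.
  by apply: connect1; rewrite /avoid /= ab ZE !inE.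
(* A neighbour of [v] has a second neighbour, which is not adjacent to [v] for want of triangles. *)
have out z : z != v -> exists2 z', z' \notin closed_star v & connect (avoid Z) z z'.
  move=> zv; case: (boolP (z \in closed_star v)) => [|nz]; last by exists z.
  rewrite !inE (negbTE zv) /= => vz; have zv' : adj z v by rewrite adj_sym.
  have /card_gt1P[a [b [za zb ab]]] := card_nbhd_gt1 nv zv'.
  have [z' zz' z'v] : exists2 z', adj z z' & z' != v.
    rewrite !inE in za zb; case: (eqVneq a v) => [av|]; last by exists a.
    by exists b => //; rewrite -av eq_sym.
  exists z'; last by apply: connect1; rewrite /avoid /= zz' ZE !inE zv.
  by rewrite !inE negb_or z'v /= (no_triangle girth vz zz').
move: xZ yZ; rewrite ZE !inE -ZE => /out[x' x'v xx'] /out[y' y'v yy'].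
apply: connect_trans xx' _; apply: (@connect_trans _ _ y'); last first.
  suff -> : connect_sym (avoid Z) by [].
  apply: sym_connect_sym => a b; rewrite /avoid /=.
  by rewrite adj_sym [(a \notin Z) && _]andbC.
move: (star _ _ _ x'v y'v); apply: connect_sub => a b /and3P[ab av bv].
apply: connect1; rewrite /avoid /= ab ZE !inE.
by move: av bv; rewrite !inE !negb_or => /andP[-> _] /andP[-> _].
Qed.

Lemma atomic_has_free_links x y : atomic D -> x != y -> has_free_links D.
Proof.
move=> [[_ conn] nv girth _] xy v.
have [z vz] : exists z, adj v z.
  have [z vz] : exists z, v != z.
    by case: (eqVneq v x) => [->|]; [exists y|exists x].
  case/connectP: (conn v z) => [[|b p]] /=; first by move=> _ e; rewrite e eqxx in vz.
  by case/andP=> vb _ _; exists b.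
have /card_gt1P[a [b [va vb ab]]] := card_nbhd_gt1 nv vz.
rewrite !inE in va vb; exists a, b; split=> //.
by apply/negP=> e; move: vb; rewrite (no_triangle girth va e).
Qed.
End GraphFacts.

(* [X] embeds [D] as an induced subgraph of the extension graph of [H]. *)
Record iemb D H (X : vert D -> raag H) : Prop := Iemb {
  iembE : forall v, isE (X v);
  iembC : forall u v, commute (X u) (X v) <-> u = v \/ adj u v;
  iemb_inj : injective X }.

Lemma emap_iemb D H (phi : raag D -> raag H) g : emap phi ->
  iemb (fun v => phi (gv v ^ g)).
Proof.
move=> [E C I _]; have Eg v : isE (gv v ^ g) by apply/isEJ/isE_gv.
split=> [v|u v|u v]; first exact: E.
  by rewrite C // commuteJ commute_gv2.
by move/I => e; apply: (@gv_conj_inj _ u v g g); apply: e.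
Qed.

Lemma emap_iemb1 D H (phi : raag D -> raag H) : emap phi -> iemb (fun v => phi (gv v)).
Proof.
move=> ep; have [E C I] := emap_iemb 1 ep.
by split=> [v|u v|u v]; [have := E v | have := C u v | have := I u v]; rewrite !conjg1.
Qed.

(** Along a path in [D] the images can change sides only through [Z], the vertices whose images
    commute with [om]. So [Z] separates [D], hence has two elements and is not a closed star. *)
Lemma iemb_wall D H (X : vert D -> raag H) h a x y : well_connected D -> iemb X ->
  onside h a true (X x) -> onside h a false (X y) ->
  (exists u v, [/\ u != v, commute (gv a.1 ^ h) (X u) & commute (gv a.1 ^ h) (X v)]) /\
  forall w, X w <> gv a.1 ^ h.
Proof.
move=> conn [E C I] hx hy; pose om := gv a.1 ^ h.
pose Z := [set v | `[< commute om (X v) >]].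
have nZ s v : onside h a s (X v) -> v \notin Z.
  by move=> hv; rewrite inE; apply/asboolP=> /commute_sym; apply: onside_not_commute hv.
have nconn : ~ connect (avoid Z) x y.
  case/connectP=> p xp yp; rewrite {y}yp in hy.
  elim: p x hx xp hy => [|b p IH] x hx /=; first by move=> _; apply: onside_absurd hx.
  case/andP=> /and3P[xb _ bZ] bp; apply: IH bp; apply: onside_commute hx => //.
    by apply/C; right.
  by move/commute_sym=> c; case/negP: bZ; rewrite inE; apply/asboolP.
split=> [|w ew].
  case: (ltnP 1 #|Z|) => [/card_gt1P[u [v [uZ vZ uv]]]|le1].
    by exists u, v; split=> //; apply/asboolP; [move: uZ|move: vZ]; rewrite inE.
  by case: nconn; apply: conn; [apply: nZ hx|apply: nZ hy|left].
case: nconn; apply: conn; [exact: nZ hx|exact: nZ hy|right; exists w].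
apply/setP=> v; rewrite !inE /om -ew; apply/asboolP/idP => [/C[->|->]|].
- by rewrite eqxx.
- by rewrite orbT.
- by move=> e; apply/C; case/orP: e => [/eqP->|]; [left|right].
Qed.

(** * Pairs whose images have a common neighbour *)

Section CommonNeighbours.
Variables D H : sgraph.
Implicit Types (X : vert D -> raag H) (u v : vert D) (W : raag H).

Definition common_nbr X u v W :=
  [/\ isE W, W <> X u, W <> X v, commute W (X u) & commute W (X v)].

Definition linked X : {set vert D * vert D} :=
  [set uv | (uv.1 != uv.2) && `[< exists W, common_nbr X uv.1 uv.2 W >]].

Lemma linkedP X u v : reflect (u != v /\ exists W, common_nbr X u v W) ((u, v) \in linked X).
Proof. by rewrite inE; apply: (iffP andP) => /= -[uv /asboolP]. Qed.

Lemma common_nbr_uniq_iemb X u v W W' : no_short_cycles H -> iemb X -> u != v ->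
  common_nbr X u v W -> common_nbr X u v W' -> W = W'.
Proof.
move=> girth [E _ I] uv [EW Wu Wv cu cv] [EW' Wu' Wv' cu' cv'].
apply: (isE_common_uniq girth (E u) (E v)) => //.
by move/I => e; rewrite e eqxx in uv.
Qed.

Lemma iemb_wall_nbr X h a x y : well_connected D -> iemb X ->
  onside h a true (X x) -> onside h a false (X y) ->
  (exists u v, u != v /\ common_nbr X u v (gv a.1 ^ h)) /\ forall w, X w <> gv a.1 ^ h.
Proof.
move=> conn emb hx hy; have [[u [v [uv cu cv]]] n] := iemb_wall conn emb hx hy.
split=> //; exists u, v; split=> //; split=> //; try by apply/nesym.
exact/isEJ/isE_gv.
Qed.
End CommonNeighbours.

Lemma common_nbr_emap D H K (chi : raag H -> raag K) (X : vert D -> raag H) u v W :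
  iemb X -> emap chi -> common_nbr X u v W -> common_nbr (chi \o X) u v (chi W).
Proof.
move=> [E _ _] [Ec Cc Ic _] [EW Wu Wv cu cv]; split=> /=; first exact: Ec.
- by move/Ic => e; apply: Wu; apply: e.
- by move/Ic => e; apply: Wv; apply: e.
- exact/Cc.
- exact/Cc.
Qed.

Lemma linked_emap D H K (chi : raag H -> raag K) (X : vert D -> raag H) :
  iemb X -> emap chi -> linked X \subset linked (chi \o X).
Proof.
move=> emb ec; apply/subsetP=> -[u v] /linkedP[uv [W cW]]; apply/linkedP; split=> //.
by exists (chi W); apply: common_nbr_emap.
Qed.

(** * Self-maps of the extension graph *)

Section SelfMaps.
Variable D : sgraph.
Hypotheses (girth : no_short_cycles D) (conn : well_connected D).
Implicit Types (psi chi : raag D -> raag D) (g h W : raag D) (u v : vert D).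

Definition vimg psi v := psi (gv v).

(** The wall's vertex commutes with two images. If it were [psi W], then [W] would commute with two
    vertices of the translate by [g], so would lie in that translate, against [iemb_wall]. *)
Lemma emap_wall_not_image psi g h a x y W : emap psi ->
  onside h a true (psi (gv x ^ g)) -> onside h a false (psi (gv y ^ g)) -> isE W ->
  psi W <> gv a.1 ^ h.
Proof.
move=> ep hx hy EW eW.
have [[u [v [uv [_ _ _ cu cv]]]] n] := iemb_wall_nbr conn (emap_iemb g ep) hx hy.
have Eg w : isE (gv w ^ g) by apply/isEJ/isE_gv.
rewrite -eW !(emapC ep) // !commute_conjVr in cu cv.
have [w ew] := isE_common_gv girth uv (isEJ g^-1 EW) cu cv.
by apply: (n w); rewrite -eW -ew conjgKV.
Qed.

Section Maximal.
Variable psi : raag D -> raag D.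
Hypothesis ep : emap psi.
Hypothesis psi_max : forall chi, emap chi -> #|linked (vimg chi)| <= #|linked (vimg psi)|.

Let emb : iemb (vimg psi) := emap_iemb1 ep.

(** Designed to contain the vertex of every wall that separates two vertices [psi (gv v)]. *)
Definition hull W := (exists v, W = vimg psi v) \/
  (exists u v, u != v /\ common_nbr (vimg psi) u v W).

Lemma hull_isE W : hull W -> isE W.
Proof. by case=> [[v ->]|[u [v [_ []]]]] //; apply: (iembE emb). Qed.

Lemma linked_max chi : emap chi -> linked (chi \o vimg psi) = linked (vimg psi).
Proof.
move=> ec; apply/esym/eqP; rewrite eqEcard linked_emap //=.
exact: (psi_max (emap_comp ep ec)).
Qed.

(** For a common neighbour [W] of two images, one of their further images does not commute with the
    wall's vertex and so is on the side of [psi W]. Otherwise [psi W] and the wall's vertex would be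
    common neighbours of the same pair, hence equal. *)
Lemma hull_onside h a s W : (forall V, isE V -> psi V <> gv a.1 ^ h) -> hull W ->
  onside h a s (psi W) -> exists v, onside h a s (psi (vimg psi v)).
Proof.
move=> nim hW hs; have EW := hull_isE hW; case: hW => [[v eW]|[u [v [uv cW]]]].
  by exists v; rewrite -eW.
have Ev w : isE (psi (vimg psi w)) by apply/(emapE ep)/(iembE emb).
have [_ Wu Wv cu cv] := common_nbr_emap emb ep cW.
case: (EM (commute (psi (vimg psi u)) (gv a.1 ^ h))) => [ou|nu]; last first.
  by exists u; apply: onside_commute hs => //; apply: (emapE ep).
case: (EM (commute (psi (vimg psi v)) (gv a.1 ^ h))) => [ov|nv]; last first.
  by exists v; apply: onside_commute hs => //; apply: (emapE ep).
case: (nim W EW).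
apply: (isE_common_uniq girth (Ev u) (Ev v)) => //.
- exact: (emapE ep).
- exact/isEJ/isE_gv.
- by move/(emap_inj ep) => /(_ (iembE emb u) (iembE emb v)) /(iemb_inj emb) e; rewrite e eqxx in uv.
- by move=> e; apply: (nim _ (iembE emb u)).
Qed.

(** A separating wall would also separate images under [psi \o psi], so its vertex links a pair
    there. By maximality [psi] already links this pair through some [W], and uniqueness makes the
    wall's vertex [psi W], which is excluded. *)
Lemma hull_common_point g : exists h, forall u, hull (gv u ^ g) -> onT h (psi (gv u ^ g)).
Proof.
have [u|[h hP]|[h [a [i [j [/asboolP Ui /asboolP Uj hi hj]]]]]] :=
  @common_point_or_wall D _ (fun u => psi (gv u ^ g)) (fun u => `[< hull (gv u ^ g) >]).
- by apply: (iembE (emap_iemb g ep)).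
- by exists h => u hu; apply: hP; apply/asboolP.
have nim := fun V => emap_wall_not_image ep hi hj (W := V).
have [x hx] := hull_onside nim Ui hi; have [y hy] := hull_onside nim Uj hj.
have epp : iemb (psi \o vimg psi) := emap_iemb1 (emap_comp ep ep).
have [[u [v [uv cW]]] n] := iemb_wall_nbr conn epp hx hy.
have : (u, v) \in linked (psi \o vimg psi).
  by apply/linkedP; split=> //; exists (gv a.1 ^ h).
rewrite (linked_max ep) => /linkedP[_ [W cW']].
have EW : isE W by case: cW'.
by case: (nim W EW); apply: (common_nbr_uniq_iemb girth epp uv (common_nbr_emap emb ep cW')).
Qed.

(* Among all translates of [D] take one, [D ^ g], meeting the hull in as many vertices as possible.
   The image of this intersection is again a largest intersection with a translate [D ^ h], and it
   consists of vertices of [psi D]; walking from [h] towards a vertex of [psi D] outside [D ^ h]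
   would enlarge it. *)
Lemma maximal_common_point : exists h, forall v, onT h (vimg psi v).
Proof.
pose N g := [set u | `[< hull (gv u ^ g) >]].
have [||g _ gmax] := @ex_max_measure _ (fun=> True) (fun g => #|N g|) #|vert D|.
- by move=> g; apply: max_card.
- by exists 1.
have [th thJ] := emapJ ep; have [h0 h0P] := hull_common_point g.
(* Conjugating by [g] before [psi] amounts to conjugating by [th g] after it; [h] undoes this. *)
pose h := h0 * (th g)^-1.
have hon u : u \in N g -> onT h (vimg psi u).
  rewrite inE => /asboolP /h0P; rewrite thJ; last exact: isE_gv.
  by case=> w ew; exists w; rewrite conjgM -ew conjgK.
have /choice[lab labP] : forall v, exists w, v \in N g -> vimg psi v = gv w ^ h.
  move=> v; case: (boolP (v \in N g)) => [/hon[w ew]|_]; last by exists v.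
  by exists w.
have labI : {in N g &, injective lab}.
  by move=> v v' /labP e /labP e' ee; apply: (iemb_inj emb); rewrite e e' ee.
have labS : lab @: N g \subset N h.
  apply/subsetP=> _ /imsetP[v vN ->]; rewrite inE; apply/asboolP; left; exists v.
  by rewrite labP.
have Nh u : u \in N h -> exists v, gv u ^ h = vimg psi v.
  have /eqP <- : lab @: N g == N h.
    by rewrite eqEcard labS (card_in_imset labI) gmax.
  by case/imsetP=> v vN ->; exists v; rewrite labP.
have hmax h' : N h \subset N h' -> N h' \subset N h.
  move=> s; have /eqP <- // : N h == N h'; rewrite eqEcard s.
  apply: leq_trans (gmax h' I) _; rewrite -(card_in_imset labI).
  exact: subset_leq_card.
have Nsub h' : (forall v, onT h (vimg psi v) -> onT h' (vimg psi v)) ->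
    N h \subset N h' /\ forall u, u \in N h -> gv u ^ h = gv u ^ h'.
  move=> on; have e u : u \in N h -> gv u ^ h = gv u ^ h'.
    move=> uN; have [v ev] := Nh u uN; have [|w ew] := on v; first by exists u.
    by rewrite ev ew -(@gv_conj_inj _ u w h h') // ev ew.
  split=> //; apply/subsetP=> u uN; rewrite inE -e //; by rewrite inE in uN.
exists h => s; apply: contrapT => ns.
have [[h' [[w ew] h'T]]|[h' [a [t [[y ey] h'T hs ht]]]]] :=
  @walk D (fun t => exists v, t = vimg psi v) h (vimg psi s) (iembE emb s).
- have [sN eN] := Nsub h' (fun v => h'T _ (ex_intro _ v erefl)).
  have /(subsetP (hmax _ sN)) wN : w \in N h'.
    by rewrite inE; apply/asboolP; left; exists s.
  by apply: ns; exists w; rewrite ew eN.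
- have [sN eN] := Nsub h' (fun v => h'T _ (ex_intro _ v erefl)).
  rewrite ey in ht; have [[u [v [uv cW]]] n] := iemb_wall_nbr conn emb hs ht.
  (* The wall's vertex is in the hull, so its label lies in [N h'] and hence in [N h], making it an
     image, which [iemb_wall] forbids. *)
  have /(subsetP (hmax _ sN)) aN : a.1 \in N h'.
    by rewrite inE; apply/asboolP; right; exists u, v.
  by have [z ez] := Nh _ aN; apply: (n z); rewrite -ez eN.
Qed.
End Maximal.

(** A maximal [psi] maps [D] into one translate, bijectively on labels by finiteness. Common
    neighbours of images then lie in that translate and pull back to [D], so even [psi] links no new
    pair. *)
Lemma linked_self chi : emap chi -> linked (vimg chi) = linked (@gv D).
Proof.
move=> ec; have [||psi ep pmax] := @ex_max_measure _ (@emap D D)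
    (fun psi => #|linked (vimg psi)|) #|{: vert D * vert D}|.
- by move=> psi; apply: max_card.
- by exists id; apply: emap_id.
have [h hP] := maximal_common_point ep pmax.
have emb : iemb (vimg psi) := emap_iemb1 ep.
have s : linked (vimg psi) \subset linked (@gv D).
  apply/subsetP=> -[u v] /linkedP[uv [W [EW Wu Wv cu cv]]]; apply/linkedP; split=> //.
  have /choice[lab labP] := hP.
  have labI : injective lab.
    by move=> x y e; apply: (iemb_inj emb); rewrite !labP e.
  have [lab' labK lab'K] := injF_bij labI.
  have luv : lab u != lab v by apply: contra uv => /eqP/labI/eqP.
  rewrite !labP !commute_conjVr in cu cv.
  have [w ew] := isE_common_gv girth luv (isEJ h^-1 EW) cu cv.
  have eW : W = vimg psi (lab' w) by rewrite labP lab'K -ew conjgKV.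
  have cc x : commute W (vimg psi x) -> commute (gv (lab' w)) (gv x).
    by rewrite eW => /(iembC emb)/commute_gv2.
  exists (gv (lab' w)); split; first exact: isE_gv.
  - by move=> e; apply: Wu; rewrite eW /vimg e.
  - by move=> e; apply: Wv; rewrite eW /vimg e.
  - by apply: cc; rewrite labP commute_conjVr.
  - by apply: cc; rewrite labP commute_conjVr.
have s' : linked (@gv D) \subset linked (vimg chi).
  exact: (linked_emap (emap_iemb1 (emap_id D)) ec).
apply/esym/eqP; rewrite eqEcard s' /=; apply: leq_trans (pmax _ ec) _.
exact: subset_leq_card.
Qed.
End SelfMaps.

(** * Mutual embeddings and the isomorphism *)

Lemma emap_common_point D H (phi : raag D -> raag H) (phi' : raag H -> raag D) :
  no_short_cycles D -> well_connected D -> no_short_cycles H -> emap phi -> emap phi' ->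
  exists h, forall v, onT h (phi (gv v)).
Proof.
move=> gD conn gH ep ep'; have emb := emap_iemb1 ep.
have [v|[h hP]|[h [a [x [y [_ _ hx hy]]]]]] :=
  @common_point_or_wall H _ (fun v => phi (gv v)) predT; first exact: (iembE emb).
  by exists h => v; apply: hP.
have [[u [v [uv cW]]] n] := iemb_wall_nbr conn emb hx hy.
(* Pushed to [D] by [phi'], the link must already exist in [D] by [linked_self]; uniqueness then
   makes the wall's vertex the image of a generator. *)
have : (u, v) \in linked (vimg (phi' \o phi)).
  apply/linkedP; split=> //; exists (phi' (gv a.1 ^ h)).
  exact: (common_nbr_emap emb ep' cW).
rewrite linked_self //; last exact: emap_comp.
case/linkedP=> _ [W [EW Wu Wv cu cv]].
have [w ew] := isE_common_gv gD uv EW cu cv.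
case: (n w); rewrite -ew; apply: (common_nbr_uniq_iemb gH emb uv _ cW).
exact: (common_nbr_emap (emap_iemb1 (emap_id D)) ep).
Qed.

Lemma emap_graph_embedding D H (phi : raag D -> raag H) (phi' : raag H -> raag D) :
  no_short_cycles D -> well_connected D -> no_short_cycles H -> emap phi -> emap phi' ->
  exists f : vert D -> vert H, injective f /\ forall x y, adj (f x) (f y) = adj x y.
Proof.
move=> gD conn gH ep ep'; have emb := emap_iemb1 ep.
have [h /choice[f fP]] := emap_common_point gD conn gH ep ep'.
have fI : injective f by move=> x y e; apply: (iemb_inj emb); rewrite /= fP fP e.
exists f; split=> // x y; case: (eqVneq x y) => [->|xy]; first by rewrite !adj_irr.
have := iembC emb x y; rewrite /= !fP commuteJ commute_gv2 => -[c1 c2].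
apply/idP/idP => e.
  by case: c1 => [|exy|//]; [right|rewrite exy eqxx in xy].
by case: c2 => [|/fI exy|//]; [right|rewrite exy eqxx in xy].
Qed.

Lemma graph_iso_raag_embeds D H : graph_iso D H -> raag_embeds D H.
Proof.
case=> f [[f' fK f'K] fadj].
pose mp (l : letter D) : letter H := (f l.1, l.2).
pose mp' (l : letter H) : letter D := (f' l.1, l.2).
pose F v : word H := [:: (f v, false)].
have FE w : wsubst F w = map mp w.
  by rewrite /wsubst; elim: w => //= -[v e] w ->; case: e.
have back w1 w2 : raag_eq w1 w2 -> raag_eq (map mp' w1) (map mp' w2).
  elim=> {w1 w2}.
  - by move=> w; apply: req_refl.
  - by move=> w1 w2 _; apply: req_sym.
  - by move=> w1 w2 w3 _ s12 _; apply: req_trans.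
  - by move=> u v x; rewrite !map_cat; apply: (req_free _ _ (mp' x)).
  - move=> u v x y xy; rewrite !map_cat; apply: (@req_rel _ _ _ (f' x) (f' y)).
    by rewrite -fadj !f'K.
exists F; split=> [u v uv|w].
  rewrite FE; have := @req_rel H [::] [::] (f u) (f v); rewrite fadj => /(_ uv).
  by rewrite cats0.
rewrite FE => /back; rewrite -map_comp map_id_in // => -[v e] _ /=.
by rewrite /mp' /= fK.
Qed.

Lemma graph_iso_sym D H : graph_iso D H -> graph_iso H D.
Proof.
case=> f [[f' fK f'K] fadj]; exists f'; split; first by exists f.
by move=> x y; rewrite -fadj !f'K.
Qed.

Lemma trivial_graph_commute D (x y : raag D) : (forall u v : vert D, u = v) -> commute x y.
Proof.
by move=> triv; rewrite -[x]nfK -[y]nfK; apply: commute_cls => a b _ _; apply: lgen_comm_eq.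
Qed.

(** A one-vertex graph is atomic with abelian group, while an atomic graph with two distinct
    vertices has non-commuting generators. *)
Lemma raag_embeds_trivial D H : atomic D -> raag_embeds D H ->
  (forall u v : vert H, u = v) -> forall u v : vert D, u = v.
Proof.
move=> aD /raag_embeds_morphism[F [FM Finj]] triv u v; apply/eqP/negPn/negP=> uv.
have [a [b [_ _ ab nab]]] := atomic_has_free_links aD uv u.
have : commute (gv a) (gv b).
  by apply: Finj; rewrite !FM; apply: trivial_graph_commute.
by case/commute_gv2=> [e|e]; [rewrite e eqxx in ab|rewrite e in nab].
Qed.

Lemma embeds_graph_embedding D H : atomic D -> atomic H -> raag_embeds D H -> raag_embeds H D ->
  exists f : vert D -> vert H, injective f /\ forall x y, adj (f x) (f y) = adj x y.
Proof.
move=> aD aH eDH eHD.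
(* With a single vertex there are no free links, so this case is settled by hand. *)
case: (EM (forall u v : vert D, u = v)) => [triv|nD].
  have [[/card_gt0P[y0 _] _] _ _ _] := aH.
  exists (fun=> y0); split=> [u v _|u v]; first exact: triv.
  by rewrite (triv u v) !adj_irr.
have nontriv K : ~ (forall u v : vert K, u = v) -> exists u v : vert K, u != v.
  move=> n; apply: contrapT => no; apply: n => u v; apply/eqP/negPn/negP=> uv.
  by apply: no; exists u, v.
have [u [v uv]] := nontriv _ nD.
have [u' [v' uv']] : exists u v : vert H, u != v.
  by apply: nontriv => /(raag_embeds_trivial aD eDH).
have [_ _ gD _] := aD; have [_ _ gH _] := aH.
have [F [FM FI]] := raag_embeds_morphism eDH; have [F' [FM' FI']] := raag_embeds_morphism eHD.
have [phi ep] := emap_of_morphism gH (atomic_has_free_links aD uv) FM FI.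
have [phi' ep'] := emap_of_morphism gD (atomic_has_free_links aH uv') FM' FI'.
exact: (emap_graph_embedding gD (atomic_well_connected aD) gH ep ep').
Qed.

Theorem mainTheorem8 (D H : sgraph) :
  atomic D -> atomic H ->
  (raag_embeds D H /\ raag_embeds H D <-> graph_iso D H).
Proof.
move=> aD aH; split=> [[eDH eHD]|iso]; last first.
  by split; apply: graph_iso_raag_embeds => //; apply: graph_iso_sym.
have [f [fI fadj]] := embeds_graph_embedding aD aH eDH eHD.
have [f' [f'I _]] := embeds_graph_embedding aH aD eHD eDH.
(* The reverse injection bounds the cardinality, so the injection [f] between finite sets is
   bijective. *)
exists f; split=> //; apply: inj_card_bij => //; exact: leq_card f'I.
Qed.
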